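(* Let $S,B\subseteq([-1,1]\cup\{*\})^X$ be real-valued hypothesis classes. For $\beta,\eta_1,\eta_2,\delta\in(0,1/2)$, letting $m:=\sup_{r:X\to\mathbb{R}}\sup_{\theta\in\mathbb{R}}\mathsf{VC}(S^{(r)}_{\eta_1},B^{(\theta)}_{\eta_2})$, \[ \#\mathsf{MA}(S,B,\beta+2\eta_1+4\eta_2,\delta)\le\#\mathsf{MC}(S,B,\beta+2\eta_1+4\eta_2,\delta)\le O\!\left(\frac m{\beta^6}\log_+^2\!\left(\frac m\beta\right)\log\!\left(\frac1{\eta_1}\right)+\frac1{\beta^6}\log\!\left(\frac1{\eta_1}\right)\log\!\left(\frac1{\beta\delta}\right)+\frac1{\beta^4}\log\!\left(\frac1{\eta_2}\right)\right). \] For $\varepsilon\in(0,1/2)$, taking $\beta=\eta_1=\eta_2=\varepsilon/7$ in the definition of $m$, one has $m\le\mathsf{fat}_{\varepsilon/7}(S,B)$ and \[ \#\mathsf{MA}(S,B,\varepsilon,\delta)\le\#\mathsf{MC}(S,B,\varepsilon,\delta)\le O\!\left(\frac m{\varepsilon^6}\log_+^2\!\left(\frac m\varepsilon\right)\log\!\left(\frac1\varepsilon\right)+\frac1{\varepsilon^6}\log\!\left(\frac1\varepsilon\right)\log\!\left(\frac1{\varepsilon\delta}\right)\right). \]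
   Context: $X$ non-empty; hypotheses $h:X\to[-1,1]\cup\{*\}$; distributions discrete. $h^{(r)}_\eta(x)=1$ if $h(x)\ne*$ and $h(x)>r(x)+\eta$, $=-1$ if $h(x)\neq*$ and $h(x)<r(x)-\eta$, $=*$ otherwise; $H^{(r)}_\eta=\{h^{(r)}_\eta:h\in H\}$; $H^{(\theta)}_\eta$ uses $r\equiv\theta$. $\mathsf{VC}(H_1,H_2)$ for binary classes: sup of $|X'|$ over $X'$ shattered by both. $\mathsf{fat}_\eta(S,B)$: sup of $|X'|$ over $X'$ that are $\eta$-fat shattered by both $S$ and $B$, where $X'$ is $\eta$-fat shattered by $H$ if for some $r:X'\to\mathbb{R}$ every $\xi:X'\to\{-1,1\}$ has $h\in H$ with $h(x)\ne*$ and $\xi(x)(h(x)-r(x))>\eta$ on $X'$. Generalized product: $u_1\diamondsuit u_2=u_1u_2$ if $u_2\in[-1,1]$, $-|u_1|$ if $u_2=*$. For a distribution $\mu$ on $X\times[-1,1]$ and $f:X\to[-1,1]$: $\mathsf{MA\text{-}error}_{\mu,B}(f)=\sup_{b\in B}\sup_{\sigma\in\{-1,1\}}\mathbb{E}_\mu[((f(x)-y)\sigma)\diamondsuit b(x)]$, and, when $f$ has countable range $V$, $\mathsf{MC\text{-}error}_{\mu,B}(f)=\sup_{b\in B}\sum_{v\in V}\sup_{\sigma\in\{-1,1\}}\mathbb{E}_\mu[((f(x)-y)\mathbf{1}(f(x)=v)\sigma)\diamondsuit b(x)]$. Realizable multiaccuracy $\mathsf{MA}_n(S,B,\varepsilon,\delta)$: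 learners taking $n$ points of $X\times[-1,1]$ and outputting $f:X\to[-1,1]$ such that for every $\mu$ for which some $s\in S$ satisfies $\Pr_{x\sim\mu|_X}[s(x)\ne*]=1$ and $\mathbb{E}_\mu[y|x]=s(x)$, with probability $\ge1-\delta$ over $n$ i.i.d. samples, $\mathsf{MA\text{-}error}_{\mu,B}(f)\le\varepsilon$. $\mathsf{MC}_n$ is the same with $\mathsf{MC\text{-}error}$ (output of countable range). $\#\mathsf{MA},\#\mathsf{MC}$ are the least such $n$. $\log_+(u)=\log_2\max\{2,u\}$. *)

(* Defs.v *)
From HB Require Import structures.
From mathcomp Require Import all_boot all_order all_algebra.
From mathcomp Require Import all_classical all_reals.
From mathcomp Require Import ereal topology normedtype sequences esum numfun exp.
Set Implicit Arguments. Unset Strict Implicit. Unset Printing Implicit Defensive.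
Import Order.TTheory GRing.Theory Num.Theory.
Local Open Scope classical_set_scope.
Local Open Scope ring_scope.

Section Defs.
Variable R : realType.

Definition ssum (T : choiceType) (D : set T) (a : T -> \bar R) : \bar R :=
  (\esum_(i in D) (a^\+ i) - \esum_(i in D) (a^\- i))%E.

Record ddist (T : Type) := DDist {
  atom : nat -> T;
  wt : nat -> R;
  wt_ge0 : forall n, 0 <= wt n;
  wt_sum1 : (\esum_(n in [set: nat]) (wt n)%:E = 1)%E }.

Definition Ex (T : Type) (mu : ddist T) (g : T -> R) : \bar R :=
  ssum [set: nat] (fun n => (wt mu n * g (atom mu n))%:E).

Definition Pn (T : Type) (mu : ddist T) (n : nat) (E : ('I_n -> T) -> Prop) : \bar R :=
  \esum_(i in [set: {ffun 'I_n -> nat}])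
     ((\prod_(k < n) wt mu (i k)) * (asbool (E (fun k => atom mu (i k))))%:R)%:E.

(** Hypotheses: X -> [-1,1] \cup {*}, with * = None. *)
Definition hyp_class (X : Type) (H : set (X -> option R)) : Prop :=
  forall h, H h -> forall x v, h x = Some v -> -1 <= v <= 1.

Definition thr (X : Type) (r : X -> R) (eta : R) (h : X -> option R) : X -> option R :=
  fun x => match h x with
           | Some v => if r x + eta < v then Some 1
                       else if v < r x - eta then Some (-1) else None
           | None => None
           end.

Definition thr_class (X : Type) (H : set (X -> option R)) (r : X -> R) (eta : R)
  : set (X -> option R) := [set thr r eta h | h in H].

Definition sgnb (b : bool) : R := if b then 1 else -1.

(** The finite set X' = image of an injective e : 'I_k -> X is shattered by a
    binary (partial) class H. *)
Definition shattered (X : Type) (H : set (X -> option R)) (k : nat) (e : 'I_k -> X) : Prop :=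
  forall xi : 'I_k -> bool, exists h, H h /\ forall i, h (e i) = Some (sgnb (xi i)).

(** VC(H1,H2): sup of |X'| over X' shattered by both (sup of the empty set read as 0). *)
Definition VC2 (X : Type) (H1 H2 : set (X -> option R)) : \bar R :=
  ereal_sup ([set 0%E] `|` [set (k%:R)%:E | k in
     [set k : nat | exists e : 'I_k -> X, injective e /\ shattered H1 e /\ shattered H2 e]]).

Definition fat_shattered (X : Type) (H : set (X -> option R)) (eta : R) (k : nat)
  (e : 'I_k -> X) : Prop :=
  exists r : 'I_k -> R, forall xi : 'I_k -> bool, exists h, H h /\
    forall i, exists v, h (e i) = Some v /\ eta < sgnb (xi i) * (v - r i).

Definition fat2 (X : Type) (eta : R) (S B : set (X -> option R)) : \bar R :=
  ereal_sup ([set 0%E] `|` [set (k%:R)%:E | k in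
     [set k : nat | exists e : 'I_k -> X, injective e /\
        fat_shattered S eta e /\ fat_shattered B eta e]]).

Definition mdim (X : Type) (S B : set (X -> option R)) (eta1 eta2 : R) : \bar R :=
  ereal_sup [set v | exists (r : X -> R) (theta : R),
    v = VC2 (thr_class S r eta1) (thr_class B (fun _ => theta) eta2)].

Definition gprod (u1 : R) (u2 : option R) : R :=
  match u2 with Some v => u1 * v | None => - `|u1| end.

Definition MAerr (X : Type) (mu : ddist (X * R)) (B : set (X -> option R)) (f : X -> R)
  : \bar R :=
  ereal_sup [set v | exists b sigma, B b /\ (sigma = 1 \/ sigma = -1) /\
    v = Ex mu (fun p => gprod ((f p.1 - p.2) * sigma) (b p.1))].

(** MC error; V = range f (assumed countable), summed as a signed sum. *)
Definition MCerr (X : Type) (mu : ddist (X * R)) (B : set (X -> option R)) (f : X -> R)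
  : \bar R :=
  ereal_sup [set w | exists b, B b /\
    w = ssum (range f) (fun v => ereal_sup [set u | exists sigma, (sigma = 1 \/ sigma = -1) /\
          u = Ex mu (fun p => gprod ((f p.1 - p.2) * (asbool (f p.1 = v))%:R * sigma) (b p.1))])].

(** mu is realizable by s: Pr_x[s(x) <> *] = 1, E[y|x] = s(x), and mu is
    supported on X x [-1,1]. *)
Definition realizable_by (X : Type) (mu : ddist (X * R)) (s : X -> option R) : Prop :=
  (forall n, 0 < wt mu n -> -1 <= (atom mu n).2 <= 1) /\
  (forall n, 0 < wt mu n -> s (atom mu n).1 <> None) /\
  (forall x v, s x = Some v ->
     Ex mu (fun p => (asbool (p.1 = x))%:R * p.2)
     = (v%:E * Ex mu (fun p => (asbool (p.1 = x))%:R))%E).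

Definition learner (X : Type) (n : nat) := ('I_n -> X * R) -> (X -> R).

Definition outputs_bounded (X : Type) (n : nat) (L : learner X n) : Prop :=
  forall smp x, -1 <= L smp x <= 1.

Definition is_MA_learner (X : Type) (S B : set (X -> option R)) (eps delta : R) (n : nat)
  (L : learner X n) : Prop :=
  outputs_bounded L /\
  forall mu : ddist (X * R), (exists s, S s /\ realizable_by mu s) ->
    ((1 - delta)%:E <= Pn mu (fun smp => (MAerr mu B (L smp) <= eps%:E)%E))%E.

Definition is_MC_learner (X : Type) (S B : set (X -> option R)) (eps delta : R) (n : nat)
  (L : learner X n) : Prop :=
  outputs_bounded L /\ (forall smp, countable (range (L smp))) /\
  forall mu : ddist (X * R), (exists s, S s /\ realizable_by mu s) ->
    ((1 - delta)%:E <= Pn mu (fun smp => (MCerr mu B (L smp) <= eps%:E)%E))%E.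

(** #MA and #MC: least n admitting a learner (inf of the empty set = +oo). *)
Definition numMA (X : Type) (S B : set (X -> option R)) (eps delta : R) : \bar R :=
  ereal_inf [set (n%:R)%:E | n in [set n : nat | exists L : learner X n, is_MA_learner S B eps delta L]].

Definition numMC (X : Type) (S B : set (X -> option R)) (eps delta : R) : \bar R :=
  ereal_inf [set (n%:R)%:E | n in [set n : nat | exists L : learner X n, is_MC_learner S B eps delta L]].

Definition logp (u : R) : R := ln (Num.max 2 u) / ln 2.

Definition in_half (t : R) : Prop := 0 < t /\ t < 1 / 2.

Definition bound1 (m beta eta1 eta2 delta : R) : R :=
  m / beta ^+ 6 * logp (m / beta) ^+ 2 * ln (1 / eta1)
  + 1 / beta ^+ 6 * ln (1 / eta1) * ln (1 / (beta * delta))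
  + 1 / beta ^+ 4 * ln (1 / eta2).

Definition bound2 (m eps delta : R) : R :=
  m / eps ^+ 6 * logp (m / eps) ^+ 2 * ln (1 / eps)
  + 1 / eps ^+ 6 * ln (1 / eps) * ln (1 / (eps * delta)).

End Defs.

(* Main.v *)
(** The agreement concept of [s] and [b], equal to their common sign where the
    thresholded [s] and [b] agree and undefined elsewhere, ranges over a partial class
    whose shattered sets are shattered by both thresholded classes, so its VC
    dimension is at most [m].  The one-inclusion graph of such a class has average
    degree at most [2 m]; ranking the vertices by successively deleting one of least
    degree yields a predictor with at most [2 m] leave-one-out errors.  Averaging over
    training sets, some [O(m / beta)] points of any sample determine a hypothesis that
    agrees with a given concept on all but a [beta / 64] fraction of the sample.

    Multicalibration error of [f] above [beta + 2 eta1 + 4 eta2] gives, after averaging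
    over a grid of thresholds for [b], such a concept correlated with [s - f].  Hence
    some hypothesis described by [O(m / beta)] sample indices, their guessed labels, a
    threshold and a sign pattern correlates with the residual [y - f].  Adding it to
    [f] lowers [E (s - f)^2] by [beta^2 / 8], so there are [O(1 / beta^2)] rounds, and
    every [f] reached has a description by [O(m / beta^3)] sample points.  A union bound
    over descriptions makes all empirical correlations accurate from
    [O~(m / beta^5)] samples on. *)
Require Import Defs.
From HB Require Import structures.
From mathcomp Require Import all_boot all_order all_algebra.
From mathcomp Require Import all_classical all_reals.
From mathcomp Require Import ereal topology normedtype sequences esum numfun exp.
From mathcomp Require Import zify ring lra.
Set Implicit Arguments. Unset Strict Implicit. Unset Printing Implicit Defensive.
Import Order.TTheory GRing.Theory Num.Theory.
Local Open Scope ring_scope.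

(** * One-inclusion graphs *)

(** The labels that a concept gives to its training points depend on the unknown [s] and on a
    benchmark [b], so they cannot be computed from the sample. Every labeling is therefore tried,
    and the observed residuals [y - f] decide which hypothesis is kept. This is why [f] lives on a
    grid of [8 q + 1] levels (so that sign patterns are finite in number), why thresholds come from
    a grid, and why the offending benchmark is a fixed function of [f] and the sign pattern. The
    same sample both describes a function and tests it; this is affordable because a description
    uses only a small fraction of the points. With [q] just above [1 / beta], the constants share
    out a budget of [1 / q]: threshold rounding and prediction mistakes take [1 / 8] of it each, a
    step is accepted at [1 / 2], and every statistical error is [1 / 64]. *)

Section OneInclusionGraph.
Local Open Scope nat_scope.
Variable T : finType.
Implicit Types (A Y D : {set T}) (V : {set {set T}}) (x y : T).

Definition flip A x := if x \in A then A :\ x else x |: A.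

Definition trace_shattered V Y :=
  [forall Z : {set T}, (Z \subset Y) ==> [exists A in V, A :&: Y == Z]].

Definition degree V A := #|[set x | flip A x \in V]%SET|.

Lemma in_flip A x z : (z \in flip A x) = ((z \in A) (+) (z == x)).
Proof.
rewrite /flip; case: ifPn => xA; rewrite !inE; case: eqVneq => [->|_] /=; by
  rewrite ?xA ?(negPf xA) ?addbF.
Qed.

Lemma sum_split_point (F : {set T} -> nat) y :
  \sum_(A : {set T}) F A = \sum_(A : {set T} | y \notin A) (F A + F (y |: A)).
Proof.
rewrite big_split/= (bigID (fun A : {set T} => y \notin A))/=; congr (_ + _).
rewrite [RHS](reindex_onto (fun A => A :\ y) (fun A => y |: A))/=; last first.
  by move=> A yA; rewrite finset.setU1K.
apply: eq_big => [A|A].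
  rewrite !inE eqxx/= negbK; apply/idP/eqP => [yA|<-]; first by rewrite finset.setD1K.
  by rewrite !inE eqxx.
by rewrite negbK => yA; rewrite finset.setD1K.
Qed.

(** Each edge is counted from both of its ends, so this is twice the number of edges. *)
Definition edge_count V := \sum_x \sum_(A : {set T}) ((A \in V) && (flip A x \in V) : nat).

Lemma degree_sumE V : \sum_(A in V) degree V A = edge_count V.
Proof.
rewrite /edge_count exchange_big/= big_mkcond/=; apply: eq_bigr => A _.
rewrite /degree -sum1_card big_mkcond/=; case: ifP => AV.
  by apply: eq_bigr => x _; rewrite inE; case: ifP.
by rewrite big1.
Qed.

(** Induction on the ground set, removing a point [y]: [U] is the projection of [V] along [y], and
    [W] collects the sets present both with and without [y]. Then [#|V| = #|U| + #|W|], there are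
    [#|W|] edges in direction [y], the other edges are covered by those of [U] and [W], and a set
    shattered by [W] stays shattered by [V] when [y] is added, so [W] has dimension at most
    [d - 1]. *)
Lemma edge_count_le d V : (forall Y, trace_shattered V Y -> #|Y| <= d) ->
  edge_count V <= 2 * d * #|V|.
Proof.
have cardE (V' : {set {set T}}) : #|V'| = \sum_(A : {set T}) (A \in V' : nat).
  by rewrite -sum1_card big_mkcond; apply: eq_bigr => A _; case: ifP.
suff H n D : #|D| = n -> forall d V, (forall A, A \in V -> A \subset D) ->
    (forall Y, trace_shattered V Y -> #|Y| <= d) -> edge_count V <= 2 * d * #|V|.
  by apply: (H _ [set: T]%SET erefl) => A _; apply: finset.subsetT.
elim: n D => [|n IH] D cD {}d {}V VD Vd.
  move/finset.cards0_eq: cD => D0; rewrite /edge_count big1// => x _.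
  rewrite big1// => A _; apply/eqP; rewrite eqb0; apply/negP => /andP[/VD + /VD].
  rewrite D0 !finset.subset0 => /eqP-> /eqP/finset.setP/(_ x).
  by rewrite in_flip !inE eqxx.
have [y yD] : exists y, y \in D by apply/card_gt0P; rewrite cD.
have cD' : #|D :\ y| = n by move: cD; rewrite (cardsD1 y) yD => -[].
pose U := [set A : {set T} | (y \notin A) && ((A \in V) || (y |: A \in V))].
pose W := [set A : {set T} | (y \notin A) && ((A \in V) && (y |: A \in V))].
have subD2 (A : {set T}) : y \notin A -> (A \in V) || (y |: A \in V) -> A \subset D :\ y.
  move=> yA AV; rewrite finset.subsetD1 yA andbT.
  case/orP: AV => /VD// h; apply: fintype.subset_trans h; exact: finset.subsetUr.
have UD A : A \in U -> A \subset D :\ y by rewrite inE => /andP[]; exact: subD2.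
have WD A : A \in W -> A \subset D :\ y.
  by rewrite inE => /and3P[yA AV _]; apply: subD2 => //; rewrite AV.
have cV : #|V| = #|U| + #|W|.
  rewrite !cardE !(sum_split_point _ y) -big_split/=; apply: eq_bigr => A yA.
  rewrite !inE eqxx/= !addn0 yA/=; by case: (A \in V); case: (_ |: _ \in V).
have notinflip (A : {set T}) x : x != y -> (y \in flip A x) = (y \in A).
  by move=> xy; rewrite in_flip eq_sym (negPf xy) addbF.
have flipU A x : x != y -> flip (y |: A) x = y |: flip A x.
  move=> xy; apply/finset.setP => z; rewrite finset.in_setU1 !in_flip finset.in_setU1.
  by case: (eqVneq z y) => [->|//]; rewrite eq_sym (negPf xy).
have eV : edge_count V <= edge_count U + edge_count W + 2 * #|W|.
  rewrite {1}/edge_count (bigD1 y)//=.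
  have -> : \sum_(A : {set T}) ((A \in V) && (flip A y \in V) : nat) = 2 * #|W|.
    rewrite cardE !(sum_split_point _ y) big_distrr/=; apply: eq_bigr => A yA.
    rewrite !inE eqxx yA/= addn0.
    have -> : flip A y = y |: A by rewrite /flip (negPf yA).
    have -> : flip (y |: A) y = A by rewrite /flip !inE eqxx/= finset.setU1K.
    by case: (A \in V); case: (_ |: _ \in V).
  rewrite addnC leq_add2r.
  apply: (@leq_trans (\sum_(x | x != y) \sum_(A : {set T}) ((A \in U) && (flip A x \in U) : nat)
     + \sum_(x | x != y) \sum_(A : {set T}) ((A \in W) && (flip A x \in W) : nat))); last first.
    by apply: leq_add; rewrite /edge_count [leqRHS](bigD1 y)//= leq_addl.
  rewrite -big_split/=; apply: leq_sum => x xy.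
  rewrite !(sum_split_point _ y) -big_split/=; apply: leq_sum => A yA.
  rewrite !inE eqxx/= !addn0 yA/= notinflip// yA/= flipU//.
  case: (A \in V); case: (_ |: A \in V) => /=; case: (flip A x \in V);
  by case: (_ |: flip A x \in V).
have Ud Y : trace_shattered U Y -> #|Y| <= d.
  move=> shY; apply: Vd; apply/forallP => Z; apply/implyP => ZY.
  have yY : y \notin Y.
    apply/negP => yY; have /forallP/(_ Y)/implyP/(_ (fintype.subxx _)) := shY.
    move=> /existsP[A /andP[+ /eqP AY]]; rewrite inE => /andP[yA _].
    by move: yY; rewrite -AY inE (negPf yA).
  have /forallP/(_ Z)/implyP/(_ ZY)/existsP[A /andP[+ /eqP AY]] := shY.
  rewrite inE => /andP[yA /orP[AV|AV]]; apply/existsP.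
    by exists A; rewrite AV AY eqxx.
  exists (y |: A); rewrite AV/= -AY; apply/eqP/finset.setP => z; rewrite !inE.
  by case: (eqVneq z y) => [->|//]; rewrite (negPf yY) !andbF.
(* The bound [d.-1] for [W] gains only if [d] is positive. A nonempty [W] ensures this: it shatters
   the empty set, so [V] shatters the single point [y]. *)
have [W0|[A0 A0W]] := finset.set_0Vmem W.
  have e0 : edge_count (finset.set0 : {set {set T}}) = 0.
    by rewrite /edge_count big1// => x _; rewrite big1// => A _; rewrite !inE.
  move: cV eV; rewrite W0 cards0 e0 => -> eV.
  by rewrite muln0 !addn0 in eV *; apply: leq_trans eV (IH _ cD' d U UD Ud).
have Wd Y : trace_shattered W Y -> #|Y|.+1 <= d.
  move=> shY.
  have yY : y \notin Y.
    apply/negP => yY; have /forallP/(_ Y)/implyP/(_ (fintype.subxx _)) := shY.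
    move=> /existsP[A /andP[+ /eqP AY]]; rewrite inE => /andP[yA _].
    by move: yY; rewrite -AY inE (negPf yA).
  have <- : #|y |: Y| = #|Y|.+1 by rewrite cardsU1 yY.
  apply: Vd; apply/forallP => Z; apply/implyP => ZY.
  have ZyY : Z :\ y \subset Y by rewrite finset.subDset.
  have /forallP/(_ (Z :\ y))/implyP/(_ ZyY)/existsP[A /andP[+ /eqP AY]] := shY.
  rewrite inE => /and3P[yA AV AyV]; apply/existsP.
  have AYz z : z != y -> ((z \in A) && (z \in Y)) = (z \in Z).
    by move=> zy; move/finset.setP/(_ z): AY; rewrite !inE zy.
  case yZ : (y \in Z).
    exists (y |: A); rewrite AyV/=; apply/eqP/finset.setP => z; rewrite !inE.
    by case: (eqVneq z y) => [->|zy]/=; rewrite ?yZ// AYz.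
  exists A; rewrite AV/=; apply/eqP/finset.setP => z; rewrite !inE.
  case: (eqVneq z y) => [->|zy]/=; last by rewrite AYz.
  by rewrite yZ (negPf yA).
have d0 : 0 < d.
  apply: leq_trans (Wd finset.set0 _); rewrite ?cards0//.
  apply/forallP => Z; apply/implyP; rewrite finset.subset0 => /eqP ->.
  by apply/existsP; exists A0; rewrite A0W finset.setI0/=.
have Wd' Y : trace_shattered W Y -> #|Y| <= d.-1 by move=> /Wd; lia.
have h1 := IH _ cD' d U UD Ud.
have h2 := IH _ cD' _ W WD Wd'.
have {}h2 : edge_count W + 2 * #|W| <= 2 * d * #|W|.
  have -> : 2 * d * #|W| = 2 * d.-1 * #|W| + 2 * #|W|.
    by rewrite -mulnDl -{1}(prednK d0) mulnS addnC.
  by rewrite leq_add2r.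
by rewrite cV mulnDr (leq_trans eV)// -addnA leq_add.
Qed.

Lemma trace_shattered_sub V V' Y : V \subset V' ->
  trace_shattered V Y -> trace_shattered V' Y.
Proof.
move=> /fintype.subsetP sV /forallP h; apply/forallP => Z; apply/implyP => ZY.
have /implyP/(_ ZY)/existsP[A /andP[AV e]] := h Z.
by apply/existsP; exists A; rewrite sV.
Qed.

(* Vertices are ranked by successively deleting one of degree at most [2 d]
   in the graph induced on those that remain. *)
Lemma degenerate_rank d V : (forall Y, trace_shattered V Y -> #|Y| <= d) ->
  exists rk : {set T} -> nat, forall A, A \in V ->
    #|[set x | (flip A x \in V) && (rk A <= rk (flip A x))]| <= 2 * d.
Proof.
move: {2}#|V| (erefl #|V|) => n; elim: n V => [|n IH] V cV Vd.
  by exists (fun=> 0) => A; rewrite (finset.cards0_eq cV) inE.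
have [A0 A0V degA0] : exists2 A0, A0 \in V & degree V A0 <= 2 * d.
  apply/exists_inP; apply: contraT; rewrite negb_exists_in => /forall_inP h.
  have := edge_count_le Vd; rewrite -degree_sumE leqNgt => /negP[].
  have : \sum_(A in V) (2 * d).+1 <= \sum_(A in V) degree V A.
    by apply: leq_sum => A AV; rewrite ltnNge h.
  rewrite sum_nat_const mulnS [#|V| * _]mulnC cV => h'.
  by apply: leq_trans h'; rewrite addSn ltnS leq_addl.
have cV' : #|V :\ A0| = n by move: cV; rewrite (cardsD1 A0) A0V => -[].
have [rk rkP] : exists rk : {set T} -> nat, forall A, A \in V :\ A0 ->
    #|[set x | (flip A x \in V :\ A0) && (rk A <= rk (flip A x))]| <= 2 * d.
  apply: IH => // Y /(trace_shattered_sub (finset.subD1set _ _)); exact: Vd.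
(* The deleted vertex gets the lowest rank, so all its neighbours count for it; the others rank
   strictly above it and never count it. *)
exists (fun A => if A == A0 then 0 else (rk A).+1) => A AV.
have [->|AA0] := eqVneq A A0.
  apply: leq_trans degA0; apply: subset_leq_card; apply/fintype.subsetP => x.
  by rewrite !inE => /andP[].
apply: leq_trans (rkP A _); last by rewrite !inE AA0.
apply: subset_leq_card; apply/fintype.subsetP => x; rewrite !inE => /andP[->].
by case: eqVneq.
Qed.

End OneInclusionGraph.

Local Open Scope classical_set_scope.

(** * Leave-one-out prediction for partial classes *)

Lemma sub_in_count (X : eqType) (p q : pred X) (s : seq X) :
  {in s, forall x, p x -> q x} -> (count p s <= count q s)%N.
Proof.
elim: s => //= x s IH pq; apply: leq_add; last first.
  by apply: IH => y ys; apply: pq; rewrite inE ys orbT.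
by have := pq x (mem_head _ _); case: (p x) => // ->.
Qed.

Section LeaveOneOut.
Local Open Scope nat_scope.
Variables (X : eqType) (A : set (X -> option bool)) (d : nat).
Implicit Types (v g a : X -> option bool) (x : X) (ys : seq X).

Definition vc_le := forall (k : nat) (e : 'I_k -> X), injective e ->
  (forall xi : 'I_k -> bool, exists2 a, A a & forall i, a (e i) = Some (xi i)) -> k <= d.

Definition upd g x (l : bool) := fun z => if z == x then Some l else g z.
Definition flip_label v x := upd v x (~~ odflt true (v x)).
Definition consistent v := exists2 a, A a & forall x, v x <> None -> a x = v x.
Definition has_domain v ys := forall x, v x <> None <-> x \in ys.
Definition restr a (p : pred X) := fun z => if p z then a z else None.

(** The points where a predictor that prefers higher rank may miss the labeling [v]: the opposite
    label is consistent too and ranks no lower. *)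
Definition conflicts (rk : (X -> option bool) -> nat) v :=
  fun x => `[< consistent (flip_label v x) >] && (rk v <= rk (flip_label v x)).

Hypothesis Ad : vc_le.

(** [lab] and [enc] identify the labelings of [ys] with subsets of ['I_k]; the consistent ones form
    a family whose shattered sets come from sets shattered by [A], so [degenerate_rank] applies. *)
Lemma rank_on_domain ys : uniq ys -> exists rk : (X -> option bool) -> nat,
  forall v, has_domain v ys -> consistent v -> count (conflicts rk v) ys <= 2 * d.
Proof.
move=> uys; pose k := size ys.
pose e (i : 'I_k) : X := tnth (in_tuple ys) i.
have e_inj : injective e by apply/tuple_uniqP.
have e_ys i : e i \in ys by exact: mem_tnth.
have ysE : ys = [seq e i | i <- enum 'I_k].
  by rewrite -[LHS]/(tval (in_tuple ys)) -map_tnth_enum.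
have inv x : x \in ys -> exists i, x = e i.
  by rewrite ysE => /mapP[i _ ->]; exists i.
pose lab (Z : {set 'I_k}) : X -> option bool := fun x =>
  if [pick i | e i == x] is Some i then Some (i \in Z) else None.
have labE Z i : lab Z (e i) = Some (i \in Z).
  rewrite /lab; case: pickP => [j /eqP/e_inj->//|/(_ i)]; by rewrite eqxx.
have labN Z x : x \notin ys -> lab Z x = None.
  rewrite /lab; case: pickP => // i /eqP <-; by rewrite e_ys.
pose enc v : {set 'I_k} := [set i | v (e i) == Some true]%SET.
have lab_enc v : has_domain v ys -> lab (enc v) = v.
  move=> hv; apply/funext => x; case: (boolP (x \in ys)) => [/[dup] xys /inv[i xi]|xys].
    rewrite xi labE inE; have /hv := xys; rewrite -xi; case: (v x) => // -[]//.
  by rewrite labN//; case E : (v x) => //; move: xys => /negP[]; apply/hv; rewrite E.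
pose V : {set {set 'I_k}} := [set Z | `[< consistent (lab Z) >]]%SET.
have Vd Y : trace_shattered V Y -> #|Y| <= d.
  move=> /forallP sh; apply: (Ad (e := fun j : 'I_#|Y| => e (enum_val j))).
    by move=> i j /e_inj/enum_val_inj.
  move=> xi; pose Z : {set 'I_k} := [set enum_val j | j in [pred j : 'I_#|Y| | xi j]]%SET.
  have ZY : Z \subset Y by apply/fintype.subsetP => _ /imsetP[j _ ->]; exact: enum_valP.
  have /implyP/(_ ZY)/existsP[A' /andP[+ /eqP A'Y]] := sh Z.
  rewrite inE => /asboolP[a Aa ha]; exists a => // i.
  rewrite ha labE//; congr Some.
  have := enum_valP i; move: A'Y => /finset.setP/(_ (enum_val i)).
  rewrite inE => + iY; rewrite iY andbT => ->.
  apply/imsetP/idP => [[j xj /enum_val_inj->]//|xj]; by exists i.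
have [rk rkP] := degenerate_rank Vd.
exists (rk \o enc) => v hv cv.
have vV : enc v \in V by rewrite inE; apply/asboolP; rewrite lab_enc.
apply: leq_trans (rkP _ vV).
rewrite {1}ysE count_map cardE -size_filter enumT.
rewrite (eq_filter (a2 := mem [set i | (flip (enc v) i \in V) && (rk (enc v) <= rk (flip (enc v) i))]%SET)).
  exact: leqnn.
move=> i /=; rewrite inE /conflicts/=.
have encE : enc (flip_label v (e i)) = flip (enc v) i.
  apply/finset.setP => j; rewrite in_flip !inE /flip_label /upd (inj_eq e_inj).
  case: (eqVneq j i) => [->|_]; last by rewrite addbF.
  by have /hv := e_ys i; case: (v (e i)) => [[]|].
rewrite encE; congr (_ && _); rewrite inE -encE; congr asbool; rewrite lab_enc// => x.
rewrite /flip_label /upd; case: eqVneq => [->|_]; last exact: hv.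
by split => // _; exact: e_ys.
Qed.

(** The two completions of a partial labeling at one point have the same domain, so ranks on
    different domains are never compared: each domain is ranked separately and [rk] reads the domain
    off its argument. *)
Lemma global_rank : exists rk : (X -> option bool) -> nat,
  forall v ys, uniq ys -> has_domain v ys -> consistent v ->
    count (conflicts rk v) ys <= 2 * d.
Proof.
have : forall D : set X, exists rk : (X -> option bool) -> nat, forall ys v,
    D = [set x | x \in ys] -> uniq ys -> has_domain v ys -> consistent v ->
    count (conflicts rk v) ys <= 2 * d.
  move=> D; have [[ys0 [Dy0 uy0]]|noys] := pselect (exists ys, D = [set x | x \in ys] /\ uniq ys).
    have [rk rkP] := rank_on_domain uy0; exists rk => ys v Dys uys hv cv.
    have ysE : ys =i ys0.
      by move=> x; move: Dys; rewrite Dy0 => /seteqP[/(_ x) h1 /(_ x) h2]; apply/idP/idP.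
    have /seq.permP -> : perm_eq ys ys0 by apply: uniq_perm.
    by apply: rkP => // x; rewrite -ysE; exact: hv.
  by exists (fun=> 0) => ys v Dys uys; case: noys; exists ys.
move=> /choice[rkD rkDP]; exists (fun v => rkD [set x | v x <> None] v) => v ys uys hv cv.
have domE : [set x | v x <> None] = [set x | x \in ys] by apply/seteqP; split => x /hv.
apply: leq_trans (rkDP _ ys v domE uys hv cv).
apply: eq_leq; apply: eq_in_count => x xys; rewrite /conflicts; congr (_ && (_ <= rkD _ _)).
apply/seteqP; split => z /=; rewrite /flip_label /upd; case: eqVneq => [->|_] //.
by have /hv := xys.
Qed.

Lemma leave_one_out : exists P : (X -> option bool) -> X -> bool,
  (forall g x l, g x = Some l -> P g x = l) /\
  forall a ys, A a -> uniq ys -> (forall x, x \in ys -> a x <> None) ->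
    count (fun x => Some (P (restr a [pred z | (z \in ys) && (z != x)]) x) != a x) ys <= 2 * d.
Proof.
have [rk rkP] := global_rank.
(* If both labels are consistent, the completion of higher rank wins, [true] on ties; a mistake is
   then a conflict of the correct labeling. *)
pose P g x := if g x is Some l then l else
  if `[< consistent (upd g x true) >] then
    if `[< consistent (upd g x false) >] then rk (upd g x false) <= rk (upd g x true)
    else true
  else false.
exists P; split => [g x l gx|a ys Aa uys ays]; first by rewrite /P gx.
pose v := restr a (mem ys).
have hv : has_domain v ys.
  by move=> x; rewrite /v /restr/=; case: ifPn => // xys; split=> // _; exact: ays.
have cv : consistent v.
  by exists a => // x; rewrite /v /restr/=; case: ifP.
apply: leq_trans (rkP v ys uys hv cv); apply: sub_in_count => x xys.
set g := restr _ _; rewrite /P.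
have -> : g x = None by rewrite /g /restr/= eqxx andbF.
have updE l : upd g x l = if a x == Some l then v else flip_label v x.
  have vx : v x = a x by rewrite /v /restr/= xys.
  have gv z : z != x -> g z = v z by move=> zx; rewrite /g /v /restr/= zx andbT.
  apply/funext => z; rewrite /upd; case: (eqVneq z x) => [->|zx].
    have := ays _ xys; rewrite -vx; case E : (v x) => [l'|]// _.
    case: eqP => [[<-]//|l'l]; rewrite /flip_label /upd eqxx E/=; congr Some.
    by move: l'l; case: l l' {E} => -[].
  by rewrite gv//; case: ifP => // _; rewrite /flip_label /upd (negPf zx).
rewrite !updE /conflicts; have := ays _ xys; case: (a x) => // l _.
have Tv : `[< consistent v >] = true by exact/asboolP.
case: l => /=; rewrite ?Tv /=; first by case: asboolP => //= _; case: leqP => //= /ltnW.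
by case: asboolP => //=; case: leqP.
Qed.

End LeaveOneOut.

(** * Averaging leave-one-out errors over training sets *)

Section Averaging.
Local Open Scope nat_scope.
Variables (X : eqType) (A : set (X -> option bool)) (d : nat).
Variable P : (X -> option bool) -> X -> bool.
Hypothesis P_id : forall g x l, g x = Some l -> P g x = l.
Hypothesis P_loo : forall a ys, A a -> uniq ys -> (forall x, x \in ys -> a x <> None) ->
  count (fun x => Some (P (restr a [pred z | (z \in ys) && (z != x)]) x) != a x) ys <= 2 * d.

Variables (N n0 : nat) (x : 'I_N -> X).

Definition errs (a : X -> option bool) (kappa : {ffun 'I_n0 -> 'I_N}) (i : 'I_N) :=
  (a (x i) != None) &&
  (Some (P (restr a [pred z | [exists l, z == x (kappa l)]]) (x i)) != a (x i)).

(** Sampled points may repeat. A repeated point is never an error, as its label is then in the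
    training data and [P_id] returns it. Hence the erroneous positions carry distinct points, and
    each is a leave-one-out mistake on the deduplicated domain [ys]. *)
Lemma sum_errs_loo a (tau : {ffun 'I_n0.+1 -> 'I_N}) : A a ->
  \sum_l errs a [ffun j => tau (lift l j)] (tau l) <= 2 * d.
Proof.
move=> Aa; pose ys := undup [seq z <- [seq x (tau l) | l <- enum 'I_n0.+1] | a z != None].
have ays z : z \in ys -> a z <> None by rewrite mem_undup mem_filter => /andP[/eqP].
apply: leq_trans (P_loo Aa (undup_uniq _) ays); rewrite -/ys.
pose E := [set l | errs a [ffun j => tau (lift l j)] (tau l)]%SET.
have -> : \sum_l errs a [ffun j => tau (lift l j)] (tau l) = #|E|.
  by rewrite -sum1_card [RHS]big_mkcond/=; apply: eq_bigr => l _; rewrite inE; case: errs.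
have others l j : l \in E -> j != l -> x (tau j) != x (tau l).
  rewrite inE => /andP[al el] jl; apply: contra el => /eqP jlx.
  case E1 : (a (x (tau l))) al => [b|]// _; apply/eqP; congr Some; apply: P_id.
  rewrite /restr/= E1.
  suff -> : [exists k, x (tau l) == x ([ffun j => tau (lift l j)] k)] by [].
  rewrite eq_sym in jl; have [k jk _] := unlift_some jl.
  by apply/existsP; exists k; rewrite ffunE -jk jlx.
rewrite cardE -(size_map (x \o tau)) -size_filter; apply: uniq_leq_size.
  rewrite map_inj_in_uniq ?enum_uniq// => l l'; rewrite !mem_enum => lE l'E /= ll'.
  by apply/eqP; apply: contraT => ne; have := others _ _ l'E ne; rewrite ll' eqxx.
move=> z /mapP[l]; rewrite mem_enum => lE -> {z} /=.
rewrite mem_filter; apply/andP; split; last first.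
  rewrite mem_undup mem_filter map_f ?mem_enum// andbT.
  by move: lE; rewrite inE => /andP[].
have := lE; rewrite inE => /andP[al]; apply: contra => /eqP <-; apply/eqP.
congr Some; congr (P _ _); apply/funext => z; rewrite /restr/=.
case: existsP => [[j /eqP]|noj].
  rewrite ffunE => zj; case: andP => // zys; case az : (a z) => [b|]//; case: zys.
  rewrite mem_undup mem_filter zj map_f ?mem_enum// -zj az; split=> //.
  by rewrite zj others// eq_sym neq_lift.
case: andP => // -[]; rewrite mem_undup mem_filter => /andP[_ /mapP[j _ zj]] zl; case: noj.
have jl : l != j by apply: contra zl => /eqP ->; rewrite zj.
by have [k jk _] := unlift_some jl; exists k; rewrite ffunE -jk zj.
Qed.

(** Holding out one of [n0 + 1] drawn indices gives the same average whichever position is held out.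
    So the mean number of errors over [kappa] is at most [2 d N / (n0 + 1)], and some [kappa] does
    no worse. *)
Lemma exists_training_set a : 0 < N -> A a ->
  exists kappa : {ffun 'I_n0 -> 'I_N}, n0.+1 * #|[set i | errs a kappa i]%SET| <= 2 * d * N.
Proof.
move=> N0 Aa.
have sumE l : \sum_(tau : {ffun 'I_n0.+1 -> 'I_N}) errs a [ffun j => tau (lift l j)] (tau l) =
    \sum_(kappa : {ffun 'I_n0 -> 'I_N}) #|[set i | errs a kappa i]%SET|.
  have -> : \sum_(kappa : {ffun 'I_n0 -> 'I_N}) #|[set i | errs a kappa i]%SET| =
      \sum_(kappa : {ffun 'I_n0 -> 'I_N}) \sum_i errs a kappa i.
    apply: eq_bigr => kappa _; rewrite -sum1_card [LHS]big_mkcond/=.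
    by apply: eq_bigr => i _; rewrite inE; case: errs.
  rewrite pair_big/=.
  pose h (p : {ffun 'I_n0 -> 'I_N} * 'I_N) : {ffun 'I_n0.+1 -> 'I_N} :=
    [ffun j => if unlift l j is Some k then p.1 k else p.2].
  rewrite (reindex h)/=; last first.
    exists (fun tau : {ffun 'I_n0.+1 -> 'I_N} => ([ffun j => tau (lift l j)], tau l)).
      move=> [kappa i] _; congr pair; last by rewrite ffunE unlift_none.
      by apply/ffunP => j; rewrite !ffunE liftK.
    by move=> tau _; apply/ffunP => j; rewrite !ffunE; case: unliftP => [k ->|->]; rewrite ?ffunE.
  apply: eq_bigr => -[kappa i] _ /=; rewrite [h _ l]ffunE unlift_none/=.
  by congr (nat_of_bool (errs _ _ _)); apply/ffunP => j; rewrite !ffunE liftK.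
have : n0.+1 * \sum_(kappa : {ffun 'I_n0 -> 'I_N}) #|[set i | errs a kappa i]%SET|
    <= 2 * d * N * N ^ n0.
  have -> : n0.+1 * \sum_(kappa : {ffun 'I_n0 -> 'I_N}) #|[set i | errs a kappa i]%SET| =
     \sum_(l < n0.+1) \sum_(tau : {ffun 'I_n0.+1 -> 'I_N}) errs a [ffun j => tau (lift l j)] (tau l).
    by rewrite [RHS](eq_bigr _ (fun l _ => sumE l)) sum_nat_const card_ord.
  rewrite exchange_big/= -mulnA -expnS.
  apply: leq_trans (leq_sum _ (fun tau _ => sum_errs_loo tau Aa)) _.
  by rewrite sum_nat_const card_ffun !card_ord mulnC.
apply: contraPP => /forallNP h; apply/negP; rewrite -ltnNge.
rewrite big_distrr/=.
have kappa0 : {ffun 'I_n0 -> 'I_N} := [ffun=> Ordinal N0].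
have -> : 2 * d * N * N ^ n0 = \sum_(kappa : {ffun 'I_n0 -> 'I_N}) 2 * d * N.
  by rewrite sum_nat_const card_ffun !card_ord mulnC.
apply: (@leq_trans (\sum_(kappa : {ffun 'I_n0 -> 'I_N}) (2 * d * N).+1)).
  rewrite !sum_nat_const mulnS -addn1 addnC leq_add2r.
  by apply/card_gt0P; exists kappa0.
by apply: leq_sum => kappa _; rewrite ltnNge; apply/negP; exact: h.
Qed.

End Averaging.

(** * Expectations under a discrete distribution *)

Section ESum.
Variable R : realType.
Local Open Scope ereal_scope.

Lemma ge0_esumZl (T : choiceType) (D : set T) (c : R) (a : T -> \bar R) :
  (0 <= c)%R -> (forall i, 0 <= a i) ->
  \esum_(i in D) (c%:E * a i) = c%:E * \esum_(i in D) a i.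
Proof.
have le (c' : R) (a' : T -> \bar R) : (0 <= c')%R -> (forall i, 0 <= a' i) ->
    \esum_(i in D) (c'%:E * a' i) <= c'%:E * \esum_(i in D) a' i.
  move=> c0 a0; apply: ge_ereal_sup => _ /= [F [finF FD] <-].
  by rewrite -ge0_mule_fsumr// lee_wpmul2l// ereal_sup_ubound//=; exists F.
move=> c0 a0; apply/le_anti; rewrite le//=.
have [c00|cn0] := eqVneq c 0%R.
  by rewrite c00 mul0e esum_ge0// => i _; rewrite mul0e.
have {cn0}c0 : (0 < c)%R by rewrite lt_neqAle eq_sym cn0.
(* The reverse inequality is the one just proved, for [c^-1]. *)
have -> : \esum_(i in D) a i = \esum_(i in D) (c^-1%:E * (c%:E * a i)).
  by apply: eq_esum => i _; rewrite muleA -EFinM mulVf ?gt_eqF// mul1e.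
rewrite -[leRHS]mul1e -(mulfV (lt0r_neq0 c0)) EFinM -muleA.
apply: lee_wpmul2l; first by rewrite lee_fin ltW.
by apply: le; [rewrite invr_ge0 ltW|move=> i; rewrite mule_ge0 ?a0// lee_fin ltW].
Qed.

Lemma esum_exchange (T1 T2 : choiceType) (D1 : set T1) (D2 : set T2) (a : T1 -> T2 -> \bar R) :
  (forall i j, 0 <= a i j) ->
  \esum_(i in D1) \esum_(j in D2) a i j = \esum_(j in D2) \esum_(i in D1) a i j.
Proof.
move=> a0; rewrite !esum_esum//.
rewrite (reindex_esum (D2 `*`` (fun=> D1)) _ (fun x => (x.2, x.1)))//; split=> //=.
- by move=> [i j] [].
- by move=> [i j] [i' j'] _ _ [-> ->].
- by move=> [i j] [/= Di Dj]; exists (j, i).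
Qed.

End ESum.

Section Expectation.
Variables (R : realType) (T : Type) (mu : ddist R T).
Implicit Types (g h p q : T -> R) (M c : R).

(** Only charged atoms are constrained, since [realizable_by] bounds the labels only there. *)
Definition bounded_ae M g := forall n, 0 < wt mu n -> `|g (atom mu n)| <= M.
Definition ae_ge0 g := forall n, 0 < wt mu n -> 0 <= g (atom mu n).

Definition nnE p : \bar R := \esum_(n in [set: nat]) (wt mu n * p (atom mu n))%:E.
Definition E g : R := fine (Ex mu g).

Lemma wt_cases n : wt mu n = 0 \/ 0 < wt mu n.
Proof. by have := wt_ge0 mu n; rewrite le_eqVlt => /orP[/eqP->|]; [left|right]. Qed.

Lemma wt_term_ge0 p n : ae_ge0 p -> 0 <= wt mu n * p (atom mu n).
Proof.
move=> p0; case: (wt_cases n) => [->|wn]; first by rewrite mul0r.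
by rewrite mulr_ge0 ?wt_ge0// p0.
Qed.

Lemma nnE_ge0 p : ae_ge0 p -> (0 <= nnE p)%E.
Proof. by move=> p0; apply: esum_ge0 => n _; rewrite lee_fin wt_term_ge0. Qed.

Lemma nnE_cst c : 0 <= c -> nnE (fun=> c) = c%:E.
Proof.
move=> c0; rewrite /nnE -[RHS]mule1 -(wt_sum1 mu) -ge0_esumZl//.
  by apply: eq_esum => n _; rewrite mulrC EFinM.
by move=> n; rewrite lee_fin wt_ge0.
Qed.

Lemma le_nnE p q : (forall n, 0 < wt mu n -> p (atom mu n) <= q (atom mu n)) ->
  (nnE p <= nnE q)%E.
Proof.
move=> pq; apply: le_esum => n _; rewrite lee_fin.
by case: (wt_cases n) => [->|wn]; rewrite ?mul0r// ler_wpM2l ?wt_ge0 ?pq.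
Qed.

Lemma nnED p q : ae_ge0 p -> ae_ge0 q -> nnE (p \+ q) = (nnE p + nnE q)%E.
Proof.
move=> p0 q0; rewrite /nnE -esumD; try by move=> n _; rewrite lee_fin wt_term_ge0.
by apply: eq_esum => n _; rewrite -EFinD mulrDr.
Qed.

Lemma nnE_fin p M : ae_ge0 p -> bounded_ae M p -> nnE p \is a fin_num.
Proof.
move=> p0 pM; rewrite ge0_fin_numE ?nnE_ge0//.
apply: (@le_lt_trans _ _ (nnE (fun=> `|M|))); last by rewrite nnE_cst// ltry.
apply: le_nnE => n wn; apply: le_trans (ler_norm _) _; apply: le_trans (pM _ wn) _.
exact: ler_norm.
Qed.

Lemma summable_term p M : ae_ge0 p -> bounded_ae M p ->
  summable [set: nat] (fun n => (wt mu n * p (atom mu n))%:E).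
Proof.
move=> p0 pM; rewrite summableE.
rewrite (_ : \esum_(_ in _) _ = nnE p); first exact: nnE_fin pM.
by apply: eq_esum => n _; rewrite gee0_abs// lee_fin wt_term_ge0.
Qed.

Lemma Ex_sub p q M M' : ae_ge0 p -> bounded_ae M p -> ae_ge0 q -> bounded_ae M' q ->
  Ex mu (p \- q) = (nnE p - nnE q)%E.
Proof.
move=> p0 pM q0 qM; rewrite /nnE -esumB; first last.
- by move=> n _; rewrite lee_fin wt_term_ge0.
- by move=> n _; rewrite lee_fin wt_term_ge0.
- exact: summable_term qM.
- exact: summable_term pM.
rewrite /Ex /ssum; have -> : (fun n => (wt mu n * (p \- q) (atom mu n))%:E) =
  (fun n => (wt mu n * p (atom mu n))%:E - (wt mu n * q (atom mu n))%:E)%E.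
  by apply/funext => n; rewrite -EFinB mulrBr.
by [].
Qed.

Lemma bounded_aeD M M' g h : bounded_ae M g -> bounded_ae M' h -> bounded_ae (M + M') (g \+ h).
Proof. by move=> gM hM n wn; apply: le_trans (ler_normD _ _) _; rewrite lerD ?gM ?hM. Qed.

Lemma bounded_ae_cst c : bounded_ae `|c| (fun=> c).
Proof. by move=> n _. Qed.

Lemma ge0_shift M g : bounded_ae M g -> ae_ge0 (fun t => g t + M).
Proof. by move=> gM n wn; have := gM _ wn; rewrite ler_norml => /andP[]; lra. Qed.

Lemma bounded_shift M g : bounded_ae M g -> bounded_ae (M + `|M|) (fun t => g t + M).
Proof. by move=> gM; apply: (bounded_aeD gM (bounded_ae_cst _)). Qed.

Lemma bound_ge0 M g : bounded_ae M g -> 0 <= M.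
Proof.
move=> gM; have [n wn] : exists n, 0 < wt mu n.
  apply: contrapT => /forallNP h; have := wt_sum1 mu; rewrite esum1.
    by move=> /eqP; rewrite eq_sym onee_eq0.
  by move=> n _; case: (wt_cases n) => [->|/h].
exact: le_trans (normr_ge0 _) (gM _ wn).
Qed.

Lemma ExE_sub M g : bounded_ae M g -> Ex mu g = (nnE (fun t => g t + M)%R - M%:E)%E.
Proof.
move=> gM; have M0 := bound_ge0 gM; rewrite -(nnE_cst M0).
rewrite -(Ex_sub (ge0_shift gM) (bounded_shift gM) _ (bounded_ae_cst M)).
  by congr Ex; apply/funext => t /=; rewrite addrK.
by move=> n wn.
Qed.

Lemma ExE M g : bounded_ae M g -> Ex mu g = (E g)%:E.
Proof.
move=> gM; rewrite /E fineK// (ExE_sub gM) fin_numB andbT.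
exact: nnE_fin (ge0_shift gM) (bounded_shift gM).
Qed.

(** The bridge between real expectations and nonnegative sums: adding the bound makes the integrand
    nonnegative on charged atoms, where sums may be rearranged freely, and the shift is cancelled
    afterwards. *)
Lemma nnE_shift M g : bounded_ae M g -> nnE (fun t => g t + M) = (E g + M)%:E.
Proof.
by move=> gM; rewrite EFinD -(ExE gM) (ExE_sub gM) subeK.
Qed.

Lemma nnEE M p : ae_ge0 p -> bounded_ae M p -> nnE p = (E p)%:E.
Proof.
move=> p0 pM; have M0 := bound_ge0 pM; rewrite -(ExE pM) (ExE_sub pM).
rewrite (nnED p0 (fun=> fun=> M0)) nnE_cst// addeK//.
Qed.

Lemma ED M M' g h : bounded_ae M g -> bounded_ae M' h -> E (g \+ h) = E g + E h.
Proof.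
move=> gM hM; have ghM := bounded_aeD gM hM; apply: (addIr (M + M')); apply: EFin_inj.
rewrite -(nnE_shift ghM) addrACA EFinD -(nnE_shift gM) -(nnE_shift hM).
rewrite -(nnED (ge0_shift gM) (ge0_shift hM)); by apply: eq_esum => n _ /=; rewrite addrACA.
Qed.

Lemma E_ge0 M g : bounded_ae M g -> ae_ge0 g -> 0 <= E g.
Proof. by move=> gM g0; rewrite -lee_fin -(nnEE g0 gM) nnE_ge0. Qed.

Lemma E_cst c : E (fun=> c) = c.
Proof.
apply: (addIr `|c|); apply: EFin_inj; rewrite -(nnE_shift (bounded_ae_cst c)) nnE_cst//.
by have := ler_norm (- c); rewrite normrN; lra.
Qed.

Lemma eq_E g h : (forall n, 0 < wt mu n -> g (atom mu n) = h (atom mu n)) -> E g = E h.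
Proof.
move=> gh; rewrite /E; congr (fine (ssum _ _)); apply/funext => n.
by case: (wt_cases n) => [->|wn]; rewrite ?mul0r// gh.
Qed.

Lemma bounded_aeN M g : bounded_ae M g -> bounded_ae M (fun t => - g t).
Proof. by move=> gM n wn; rewrite normrN gM. Qed.

Lemma EN M g : bounded_ae M g -> E (fun t => - g t) = - E g.
Proof.
move=> gM; apply/eqP; rewrite -addr_eq0 -(ED (bounded_aeN gM) gM); apply/eqP.
by rewrite -[RHS](E_cst 0); apply: eq_E => n _ /=; rewrite addNr.
Qed.

Lemma EB M M' g h : bounded_ae M g -> bounded_ae M' h -> E (fun t => g t - h t) = E g - E h.
Proof. by move=> gM hM; rewrite -(EN hM) -(ED gM (bounded_aeN hM)). Qed.

Lemma bounded_aeZ c M g : bounded_ae M g -> bounded_ae (`|c| * M) (fun t => c * g t).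
Proof. by move=> gM n wn; rewrite normrM ler_wpM2l ?gM. Qed.

Lemma EZ c M g : bounded_ae M g -> E (fun t => c * g t) = c * E g.
Proof.
move=> gM; wlog c0 : c / 0 <= c => [h|].
  have [/h//|c0] := leP 0 c.
  rewrite -[in RHS](opprK c) mulNr -h ?oppr_ge0 1?ltW// -(EN (bounded_aeZ (- c) gM)).
  by congr E; apply/funext => t; rewrite mulNr opprK.
have cgM : bounded_ae (c * M) (fun t => c * g t).
  by have := @bounded_aeZ c _ _ gM; rewrite ger0_norm.
apply: (addIr (c * M)); apply: EFin_inj; rewrite -(nnE_shift cgM) -mulrDr EFinM.
rewrite -(nnE_shift gM) /nnE -ge0_esumZl//.
  by apply: eq_esum => n _; rewrite -mulrDr mulrCA EFinM.
by move=> n; rewrite lee_fin; apply: (wt_term_ge0 n (ge0_shift gM)).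
Qed.

Lemma le_E M M' g h : bounded_ae M g -> bounded_ae M' h ->
  (forall n, 0 < wt mu n -> g (atom mu n) <= h (atom mu n)) -> E g <= E h.
Proof.
move=> gM hM gh; rewrite -subr_ge0 -(EB hM gM).
apply: (E_ge0 (bounded_aeD hM (bounded_aeN gM))) => n wn.
by rewrite subr_ge0 gh.
Qed.

Lemma E_sum (I : Type) (r : seq I) (M : R) (g : I -> T -> R) : (forall i, bounded_ae M (g i)) ->
  E (fun t => \sum_(i <- r) g i t) = \sum_(i <- r) E (g i)
  /\ exists M', bounded_ae M' (fun t => \sum_(i <- r) g i t).
Proof.
move=> gM; elim: r => [|i r [IH [M' IHM]]].
  split; first by rewrite big_nil -[RHS](E_cst 0); apply: eq_E => n _; rewrite big_nil.
  by exists 0 => n _; rewrite big_nil normr0.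
split.
  by rewrite big_cons -IH -(ED (gM i) IHM); apply: eq_E => n _; rewrite big_cons.
by exists (M + M') => n wn; rewrite big_cons; exact: (bounded_aeD (gM i) IHM).
Qed.

Section Fibers.
Variables (Y : choiceType) (phi : T -> Y) (D : set Y).
Hypothesis phiD : forall t, D (phi t).

Definition on_fiber (v : Y) g := fun t => (asbool (phi t = v))%:R * g t.

Lemma on_fiber_bounded v M g : bounded_ae M g -> bounded_ae M (on_fiber v g).
Proof.
move=> gM n wn; rewrite /on_fiber; case: asbool; rewrite ?mul1r ?mul0r ?normr0 ?gM//.
exact: bound_ge0 gM.
Qed.

Lemma on_fiber_ge0 v p : ae_ge0 p -> ae_ge0 (on_fiber v p).
Proof. by move=> p0 n wn; rewrite /on_fiber mulr_ge0// p0. Qed.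

Lemma nnE_fibers p : ae_ge0 p -> \esum_(v in D) nnE (on_fiber v p) = nnE p.
Proof.
move=> p0; rewrite /nnE esum_exchange; last first.
  by move=> v n; rewrite lee_fin wt_term_ge0//; exact: on_fiber_ge0.
apply: eq_esum => n _; set v0 := phi (atom mu n).
transitivity (\esum_(v in [set v0]) (wt mu n * on_fiber v p (atom mu n))%:E).
  rewrite esum_mkcond [RHS]esum_mkcond; apply: eq_esum => v _.
  have [->|vn] := eqVneq v v0; first by rewrite !mem_set//; exact: phiD.
  rewrite [in RHS]memNset; last by move=> /= vv; move: vn; rewrite vv eqxx.
  rewrite /on_fiber asboolF ?mul0r ?mulr0 ?if_same//.
  by move=> e; move: vn; rewrite -e eqxx.
rewrite esum_set1; last by rewrite lee_fin wt_term_ge0//; exact: on_fiber_ge0.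
by rewrite /on_fiber; case: asboolP => //= _; rewrite mul1r.
Qed.

Lemma fiber_le M M' g h : bounded_ae M g -> bounded_ae M' h ->
  (forall v, D v -> E (on_fiber v g) <= E (on_fiber v h)) -> E g <= E h.
Proof.
move=> gM hM gh; set K := Num.max M M'.
have gK : bounded_ae K g by move=> n wn; rewrite le_max gM.
have hK : bounded_ae K h by move=> n wn; rewrite le_max hM ?orbT.
have K0 := bound_ge0 gK; have c0 : bounded_ae K (fun=> K) by move=> n _; rewrite ger0_norm.
rewrite -(lerD2r K) -lee_fin -(nnE_shift gK) -(nnE_shift hK).
rewrite -!nnE_fibers; [|exact: ge0_shift..].
apply: le_esum => v Dv; have fE g' : bounded_ae K g' ->
    nnE (on_fiber v (fun t => g' t + K)) = (E (on_fiber v g') + E (on_fiber v (fun=> K)))%:E.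
  move=> gK'; rewrite (nnEE _ (on_fiber_bounded v (bounded_shift gK'))); last first.
    by apply: on_fiber_ge0; exact: ge0_shift.
  rewrite -(ED (on_fiber_bounded v gK') (on_fiber_bounded v c0)); congr (_%:E).
  by apply: eq_E => n _; rewrite /on_fiber/= mulrDr.
by rewrite !fE// lee_fin lerD2r gh.
Qed.

Lemma fiber_eq M M' g h : bounded_ae M g -> bounded_ae M' h ->
  (forall v, D v -> E (on_fiber v g) = E (on_fiber v h)) -> E g = E h.
Proof.
by move=> gM hM gh; apply/le_anti; rewrite (fiber_le gM hM) ?(fiber_le hM gM)// => v Dv; rewrite gh.
Qed.

(** The signed sum may be infinite; it converges because its terms are differences of two
    nonnegative families with finite sums [E g + M] and [M]. *)
Lemma ssum_fibers M g : bounded_ae M g -> ssum D (fun v => (E (on_fiber v g))%:E) = (E g)%:E.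
Proof.
move=> gM; have M0 := bound_ge0 gM.
have c0 : bounded_ae M (fun=> M) by move=> n _; rewrite ger0_norm.
have c0' : ae_ge0 (fun=> M) by move=> n _.
pose p v := nnE (on_fiber v (fun t => g t + M)); pose q v := nnE (on_fiber v (fun=> M)).
have pE v : p v = (E (on_fiber v (fun t => g t + M)))%:E.
  by apply: nnEE (on_fiber_bounded v (bounded_shift gM)); apply: on_fiber_ge0; exact: ge0_shift.
have qE v : q v = (E (on_fiber v (fun=> M)))%:E.
  by apply: nnEE (on_fiber_bounded v c0); apply: on_fiber_ge0.
have p0 v : (0 <= p v)%E by apply: nnE_ge0; apply: on_fiber_ge0; exact: ge0_shift.
have q0 v : (0 <= q v)%E by apply: nnE_ge0; apply: on_fiber_ge0.
have -> : (fun v => (E (on_fiber v g))%:E) = (fun v => p v - q v)%E.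
  apply/funext => v; rewrite pE qE -EFinB; congr (_%:E).
  rewrite -(EB (on_fiber_bounded v (bounded_shift gM)) (on_fiber_bounded v c0)).
  by apply: eq_E => n _; rewrite /on_fiber/= -mulrBr addrK.
have sp : \esum_(v in D) p v = (E g + M)%:E.
  by rewrite nnE_fibers ?(nnE_shift gM)//; exact: ge0_shift.
have sq : \esum_(v in D) q v = M%:E by rewrite nnE_fibers// nnE_cst.
rewrite /ssum esumB//; first by rewrite sp sq -EFinB addrK.
- by rewrite summableE (eq_esum (b := p)) ?sp// => v _; rewrite gee0_abs.
- by rewrite summableE (eq_esum (b := q)) ?sq// => v _; rewrite gee0_abs.
Qed.

End Fibers.
End Expectation.

(** * Concentration over samples *)

Lemma expR_le_quadratic (R : realType) (x : R) : `|x| <= 1 / 2 ->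
  expR x <= 1 + x + 2 * x ^+ 2.
Proof.
rewrite ler_norml => /andP[x1 x2].
have h : (1 - x) * expR x <= 1.
  have : (1 - x) * expR x <= expR (- x) * expR x.
    by rewrite ler_wpM2r ?expR_ge0// (expR_ge1Dx (- x)).
  by rewrite -expRD addNr expR0.
have : (1 - x) * expR x <= (1 - x) * (1 + x + 2 * x ^+ 2).
  (* Expanding, [(1 - x) * (1 + x + 2 * x ^+ 2) = 1 + x ^+ 2 * (1 - 2 * x)]. *)
  apply: le_trans h _; have : 0 <= x ^+ 2 * (1 - 2 * x) by rewrite mulr_ge0 ?sqr_ge0//; lra.
  by nra.
by rewrite ler_pM2l//; lra.
Qed.

Lemma norm_E_le (R : realType) (T : Type) (mu : ddist R T) (M : R) (g : T -> R) :
  bounded_ae mu M g -> `|E mu g| <= M.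
Proof.
move=> gM; rewrite ler_norml; apply/andP; split.
  rewrite -[leLHS](E_cst mu); apply: (le_E (bounded_ae_cst _) gM) => k /gM.
  by rewrite ler_norml => /andP[].
rewrite -[leRHS](E_cst mu); apply: (le_E gM (bounded_ae_cst _)) => k /gM.
by rewrite ler_norml => /andP[].
Qed.

Section Product.
Variables (R : realType) (T : Type) (mu : ddist R T) (n : nat).
Implicit Types (i : {ffun 'I_n -> nat}) (F G : {ffun 'I_n -> nat} -> R).

Definition weight i := \prod_(k < n) wt mu (i k).
Definition En F : \bar R := \esum_(i in [set: {ffun 'I_n -> nat}]) (weight i * F i)%:E.
Definition charged i := forall k, 0 < wt mu (i k).
Definition update_at i (k : 'I_n) (j : nat) : {ffun 'I_n -> nat} :=
  [ffun l => if l == k then j else i l].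

Lemma update_atE i k j l : update_at i k j l = if l == k then j else i l.
Proof. by rewrite ffunE. Qed.

Lemma weight_ge0 i : 0 <= weight i.
Proof. by apply: prodr_ge0 => k _; exact: wt_ge0. Qed.

Lemma weight_cases i : weight i = 0 \/ charged i.
Proof.
have [h|/existsNP[k h]] := pselect (charged i); [by right|left].
rewrite /weight (bigD1 k)//=; have [->|//] := wt_cases mu (i k); by rewrite mul0r.
Qed.

Lemma le_En F G : (forall i, charged i -> F i <= G i) -> (En F <= En G)%E.
Proof.
move=> FG; apply: le_esum => i _; rewrite lee_fin.
by have [->|ci] := weight_cases i; rewrite ?mul0r// ler_wpM2l ?weight_ge0 ?FG.
Qed.

Lemma En_D F G : (forall i, 0 <= F i) -> (forall i, 0 <= G i) ->
  En (fun i => F i + G i) = (En F + En G)%E.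
Proof.
move=> F0 G0; rewrite /En -esumD; try by move=> i _; rewrite lee_fin mulr_ge0 ?weight_ge0.
by apply: eq_esum => i _; rewrite -EFinD mulrDr.
Qed.

Lemma En_Z c F : 0 <= c -> (forall i, 0 <= F i) -> En (fun i => c * F i) = (c%:E * En F)%E.
Proof.
move=> c0 F0; rewrite /En -ge0_esumZl//; last by move=> i; rewrite lee_fin mulr_ge0 ?weight_ge0.
by apply: eq_esum => i _; rewrite -EFinM mulrCA.
Qed.

Lemma weight_update_at i k j : weight i * wt mu j = weight (update_at i k j) * wt mu (i k).
Proof.
rewrite /weight (bigD1 k)//= [in RHS](bigD1 k)//= update_atE eqxx.
rewrite [in RHS](eq_bigr (fun l => wt mu (i l))); last first.
  by move=> l lk; rewrite update_atE (negPf lk).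
by ring.
Qed.

(** Exchanging the [k]-th draw with a fresh independent one preserves the product weight; the
    involution [e] performs the exchange. *)
Lemma En_resample k F : (forall i, 0 <= F i) ->
  En F = \esum_(i in [set: {ffun 'I_n -> nat}]) \esum_(j in [set: nat])
           (weight i * wt mu j * F (update_at i k j))%:E.
Proof.
move=> F0.
have W0 i j : 0 <= weight i * wt mu j by rewrite mulr_ge0 ?weight_ge0 ?wt_ge0.
transitivity (\esum_(i in [set: {ffun 'I_n -> nat}]) \esum_(j in [set: nat])
    (weight i * wt mu j * F i)%:E).
  apply: eq_esum => i _; rewrite -[LHS]mule1 -(wt_sum1 mu) -ge0_esumZl.
  - by apply: eq_esum => j _; rewrite -EFinM mulrAC.
  - by rewrite mulr_ge0 ?weight_ge0.
  - by move=> j; rewrite lee_fin wt_ge0.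
rewrite !esum_esum; try by move=> i j _ _; rewrite lee_fin mulr_ge0.
pose e (p : {ffun 'I_n -> nat} * nat) := (update_at p.1 k p.2, p.1 k).
have eK : involutive e.
  move=> [i j]; rewrite /e/= update_atE eqxx; congr pair; apply/ffunP => l; rewrite !update_atE.
  by case: eqVneq => [->|].
rewrite (reindex_esum ([set: {ffun 'I_n -> nat}] `*`` (fun=> [set: nat])) _ e).
  by apply: eq_esum => -[i j] _ /=; rewrite -weight_update_at.
split.
- by [].
- by move=> p q _ _ /(can_inj eK).
- by move=> p _; exists (e p); rewrite ?eK.
Qed.

End Product.

Lemma En_cst1 (R : realType) (T : Type) (mu : ddist R T) n :
  En mu (fun _ : {ffun 'I_n -> nat} => 1) = 1%E.
Proof.
elim: n => [|n IH].
  rewrite /En (_ : [set: _] = [set [ffun k : 'I_0 => 0%N]]).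
    by rewrite esum_set1 /weight big_ord0 mulr1.
  by apply/seteqP; split=> i _//=; apply/ffunP => -[].
pose e (p : nat * {ffun 'I_n -> nat}) : {ffun 'I_n.+1 -> nat} :=
  [ffun k => if unlift ord0 k is Some l then p.2 l else p.1].
pose e' (i : {ffun 'I_n.+1 -> nat}) := (i ord0, [ffun l => i (lift ord0 l)]).
have eK : cancel e e'.
  move=> [j i]; rewrite /e' /e ffunE unlift_none; congr pair.
  by apply/ffunP => l; rewrite !ffunE liftK.
have e'K : cancel e' e.
  by move=> i; apply/ffunP => k; rewrite !ffunE; case: unliftP => [l ->|->]; rewrite ?ffunE.
rewrite /En (reindex_esum ([set: nat] `*`` (fun=> [set: {ffun 'I_n -> nat}])) _ e); last first.
  split=> //; first by move=> p q _ _ /(can_inj eK).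
  by move=> i _; exists (e' i); rewrite ?e'K.
transitivity (\esum_(k in [set: nat] `*`` (fun=> [set: {ffun 'I_n -> nat}]))
   (wt mu k.1 * weight mu k.2)%:E).
  apply: eq_esum => -[j i] _; rewrite mulr1 /weight big_ord_recl ffunE unlift_none/=.
  by congr (_ * _)%:E; apply: eq_bigr => l _; rewrite ffunE liftK.
rewrite -(esum_esum (a := fun j i => (wt mu j * weight mu i)%:E)); last first.
  by move=> j i _ _; rewrite lee_fin mulr_ge0 ?wt_ge0 ?weight_ge0.
rewrite -(wt_sum1 mu); apply: eq_esum => j _.
rewrite -[RHS]mule1 -IH -ge0_esumZl ?wt_ge0//.
  by apply: eq_esum => i _; rewrite -EFinM mulr1.
by move=> i; rewrite lee_fin mulr1 weight_ge0.
Qed.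

Section Concentration.
Variables (R : realType) (T : Type) (mu : ddist R T) (n : nat).
Implicit Types (i : {ffun 'I_n -> nat}).

(** Conditional independence without conditional expectations: [phi i] ignores the coordinates in
    [ks], so resampling one of them integrates its own factor and leaves all others unchanged. *)
Lemma En_prod_le (phi : {ffun 'I_n -> nat} -> nat -> R) (c : R) (ks : seq 'I_n) :
  uniq ks -> (forall i j, 0 <= phi i j) ->
  (forall i k j, k \in ks -> phi (update_at i k j) = phi i) ->
  (forall i, (\esum_(j in [set: nat]) (wt mu j * phi i j)%:E <= c%:E)%E) ->
  (En mu (fun i => (\prod_(k <- ks) phi i (i k))%R) <= (c ^+ size ks)%:E)%E.
Proof.
move=> + phi0; elim: ks => [_|k ks IH /= /andP[kks uks]] phik phic.
  by rewrite (_ : (fun i => _) = fun=> 1) ?En_cst1//; apply/funext => i; rewrite big_nil.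
have prod0 i (s : seq 'I_n) : 0 <= \prod_(l <- s) phi i (i l).
  by apply: prodr_ge0 => l _; exact: phi0.
have c0 : 0 <= c.
  rewrite -lee_fin; apply: le_trans (phic [ffun=> 0%N]).
  by apply: esum_ge0 => j _; rewrite lee_fin mulr_ge0 ?wt_ge0.
rewrite (En_resample mu k)//.
apply: (@le_trans _ _ (En mu (fun i => c * \prod_(l <- ks) phi i (i l)))).
  apply: le_esum => i _.
  rewrite (eq_esum (b := fun j => ((weight mu i * \prod_(l <- ks) phi i (i l))%:E
     * (wt mu j * phi i j)%:E)%E)); last first.
    move=> j _; rewrite -EFinM big_cons phik ?mem_head// update_atE eqxx.
    rewrite [X in _ * (_ * X)](_ : _ = \prod_(l <- ks) phi i (i l)).
      by congr EFin; ring.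
    rewrite big_seq [RHS]big_seq; apply: eq_bigr => l lks; rewrite update_atE.
    by case: eqVneq => // lk; move: kks; rewrite -lk lks.
  rewrite ge0_esumZl; last 2 first.
  - by rewrite mulr_ge0 ?weight_ge0.
  - by move=> j; rewrite lee_fin mulr_ge0 ?wt_ge0.
  rewrite [c * _]mulrC mulrA [leRHS]EFinM lee_wpmul2l ?lee_fin ?mulr_ge0 ?weight_ge0//.
rewrite En_Z// exprS EFinM lee_wpmul2l ?lee_fin// IH// => i l j lks.
by rewrite phik// inE lks orbT.
Qed.

(** The centred variable is at most 4 in absolute value, so [lam <= 1 / 8] keeps the exponent within
    [1 / 2], where the quadratic bound holds. The linear term has mean zero and the quadratic one is
    at most [2 * 16 * lam ^+ 2]. *)
Lemma mgf_le (g : T -> R) (lam : R) : bounded_ae mu 2 g -> 0 <= lam -> lam <= 1 / 8 ->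
  (\esum_(j in [set: nat]) (wt mu j * expR (lam * (E mu g - g (atom mu j))))%:E
     <= (1 + 32 * lam ^+ 2)%:E)%E.
Proof.
move=> g2 l0 l8; set m := E mu g.
have m2 : `|m| <= 2 by exact: norm_E_le.
pose X t := m - g t.
have X4 k : 0 < wt mu k -> `|X (atom mu k)| <= 4.
  by move=> /g2; move: m2; rewrite /X !ler_norml; lra.
have bX : bounded_ae mu 4 X by [].
have EX : E mu X = 0 by rewrite /X (EB (bounded_ae_cst m) g2) E_cst subrr.
pose p t := 1 + lam * X t + 32 * lam ^+ 2.
have bl : bounded_ae mu (`|lam| * 4) (fun t => lam * X t) by exact: bounded_aeZ.
have b1 : bounded_ae mu (`|1 + 32 * lam ^+ 2| + `|lam| * 4)
    (fun t => (1 + 32 * lam ^+ 2) + lam * X t).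
  by apply: (bounded_aeD (bounded_ae_cst _)).
have pE : E mu (fun t => (1 + 32 * lam ^+ 2) + lam * X t) = 1 + 32 * lam ^+ 2.
  by rewrite (ED (bounded_ae_cst _) bl) E_cst (EZ _ bX) EX mulr0 addr0.
have le k : 0 < wt mu k -> expR (lam * X (atom mu k)) <= 1 + 32 * lam ^+ 2 + lam * X (atom mu k).
  move=> wk; have := X4 _ wk; rewrite ler_norml => /andP[x1 x2].
  apply: le_trans (expR_le_quadratic _) _; first by rewrite ler_norml; apply/andP; split; nra.
  have : X (atom mu k) ^+ 2 <= 16 by nra.
  have : 0 <= lam ^+ 2 by exact: sqr_ge0.
  by rewrite exprMn; nra.
rewrite -pE -(nnEE _ b1); last first.
  by move=> k wk; apply: le_trans (le _ wk); exact: expR_ge0.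
exact: (@le_nnE _ _ _ (fun t => expR (lam * X t))).
Qed.

(* [I] holds the sample indices the function [g] was built from; conditionally on
   them the other points are still independent, and the former are too few to
   move the empirical mean by more than [eps / 2]. *)
Lemma deviation_le (g : {ffun 'I_n -> nat} -> T -> R) (I : {set 'I_n}) (eps : R) :
  (forall i, bounded_ae mu 2 (g i)) ->
  (forall i k j, k \notin I -> g (update_at i k j) = g i) ->
  0 < eps -> eps <= 1 -> 8 * #|I|%:R <= eps * n%:R ->
  (En mu (fun i => (asbool (eps * n%:R <
      n%:R * E mu (g i) - \sum_(k < n) g i (atom mu (i k))))%:R%R)
   <= (expR (- (n%:R * eps ^+ 2 / 512)))%:E)%E.
Proof.
move=> g2 gI e0 e1 In.
(* This value minimises the exponent per point, [32 * lam ^+ 2 - lam * eps / 2]; the minimum is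
   [- eps ^+ 2 / 512]. *)
pose lam := eps / 128.
pose phi i j := expR (lam * (E mu (g i) - g i (atom mu j))).
pose ks := [seq k <- enum 'I_n | k \notin I].
pose cst := expR (- (lam * (eps * n%:R / 2))).
have phi0 i j : 0 <= phi i j by exact: expR_ge0.
have P0 i : 0 <= \prod_(k <- ks) phi i (i k) by apply: prodr_ge0.
apply: (@le_trans _ _ (En mu (fun i => cst * \prod_(k <- ks) phi i (i k)))).
  apply: le_En => i ci; case: asboolP => [bad|_]; last by rewrite mulr_ge0 ?expR_ge0.
  rewrite -expR_sum -expRD -[leLHS]expR0 ler_expR -mulr_sumr.
  suff : eps * n%:R / 2 <= \sum_(k <- ks) (E mu (g i) - g i (atom mu (i k))).
    have : 0 < lam by rewrite /lam divr_gt0.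
    by nra.
  have split_sum : n%:R * E mu (g i) - \sum_(k < n) g i (atom mu (i k)) =
      \sum_(k in I) (E mu (g i) - g i (atom mu (i k)))
      + \sum_(k <- ks) (E mu (g i) - g i (atom mu (i k))).
    rewrite /ks big_filter big_enum_cond/=.
    transitivity (\sum_(k < n) (E mu (g i) - g i (atom mu (i k)))).
      by rewrite sumrB sumr_const card_ord mulr_natl.
    by rewrite (bigID (mem I)).
  have m2 : `|E mu (g i)| <= 2 by exact: norm_E_le.
  have : \sum_(k in I) (E mu (g i) - g i (atom mu (i k))) <= \sum_(k in I) 4.
    apply: ler_sum => k _; have := g2 i _ (ci k); move: m2; rewrite !ler_norml; lra.
  rewrite sumr_const -mulr_natl => hI; rewrite split_sum in bad.
  by lra.
rewrite En_Z ?expR_ge0//.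
apply: (@le_trans _ _ (cst%:E * ((1 + 32 * lam ^+ 2) ^+ size ks)%:E)%E).
  rewrite lee_wpmul2l ?lee_fin ?expR_ge0//.
  apply: En_prod_le => //.
  - by rewrite filter_uniq ?enum_uniq.
  - by move=> i k j; rewrite mem_filter => /andP[kI _]; rewrite /phi gI.
  - by move=> i; apply: mgf_le => //; rewrite /lam; lra.
rewrite -EFinM lee_fin.
have sk : (size ks <= n)%N by rewrite size_filter (leq_trans (count_size _ _))// size_enum_ord.
apply: (@le_trans _ _ (cst * expR (32 * lam ^+ 2 * n%:R))).
  rewrite ler_wpM2l ?expR_ge0//.
  apply: (@le_trans _ _ (expR (32 * lam ^+ 2) ^+ size ks)).
    rewrite lerXn2r ?nnegrE ?expR_ge0 ?expR_ge1Dx//.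
    by have := sqr_ge0 lam; lra.
  rewrite -expRM_natl ler_expR mulrC ler_wpM2l ?ler_nat//.
  by have := sqr_ge0 lam; lra.
rewrite -expRD ler_expR /lam.
by rewrite le_eqVlt; apply/orP; left; apply/eqP; field.
Qed.

(** Union bound over descriptions [c]. The tested function may itself depend on the sample, but only
    through the positions [I c], as [deviation_le] requires. *)
Lemma Pn_ge (C : finType) (g : C -> ('I_n -> T) -> T -> R) (I : C -> {set 'I_n})
    (eps delta : R) (Ev : ('I_n -> T) -> Prop) :
  (forall c w, bounded_ae mu 2 (g c w)) ->
  (forall c w w', (forall k, k \in I c -> w k = w' k) -> g c w = g c w') ->
  0 < eps -> eps <= 1 -> (forall c, 8 * #|I c|%:R <= eps * n%:R) ->
  #|C|%:R * expR (- (n%:R * eps ^+ 2 / 512)) <= delta ->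
  (forall w, (forall k, exists2 j, 0 < wt mu j & w k = atom mu j) ->
    (forall c, n%:R * E mu (g c w) - \sum_(k < n) g c w (w k) <= eps * n%:R) -> Ev w) ->
  ((1 - delta)%:E <= Pn mu Ev)%E.
Proof.
move=> g2 gI e0 e1 In Cd good.
pose smp i k := atom mu (i k).
pose bad c i := (asbool (eps * n%:R <
   n%:R * E mu (g c (smp i)) - \sum_(k < n) g c (smp i) (smp i k)))%:R : R.
have bad0 c i : 0 <= bad c i by rewrite ler0n.
have -> : Pn mu Ev = En mu (fun i => (asbool (Ev (smp i)))%:R) by [].
rewrite EFinB leeBlDr//; rewrite -(En_cst1 mu n).
apply: (@le_trans _ _ (En mu (fun i => (asbool (Ev (smp i)))%:R + \sum_c bad c i))).
  apply: le_En => i ci; case: asboolP => [_|nE].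
    by rewrite lerDl sumr_ge0.
  have [c hc] : exists c, eps * n%:R <
      n%:R * E mu (g c (smp i)) - \sum_(k < n) g c (smp i) (smp i k).
    apply: contrapT => /forallNP h; apply: nE; apply: good.
      by move=> k; exists (i k).
    by move=> c; rewrite leNgt; apply/negP; exact: h.
  rewrite add0r (bigD1 c)//= /bad asboolT// lerDl sumr_ge0//.
rewrite En_D//; last by move=> i; rewrite sumr_ge0.
rewrite leeD2l//.
have -> : En mu (fun i => \sum_c bad c i) = (\sum_c En mu (bad c))%E.
  rewrite /En -esum_sum; last by move=> i c _ _; rewrite lee_fin mulr_ge0 ?weight_ge0.
  by apply: eq_esum => i _; rewrite mulr_sumr sumEFin.
apply: (@le_trans _ _ (\sum_(c : C) (expR (- (n%:R * eps ^+ 2 / 512)))%:E)%E).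
  apply: lee_sum => c _; apply: (deviation_le (I := I c)) => //.
  move=> i k j kI; apply: gI => l lI; rewrite /smp update_atE; case: eqVneq => // lk.
  by move: kI; rewrite -lk lI.
by rewrite sumEFin lee_fin sumr_const -[leLHS]mulr_natl.
Qed.

End Concentration.

(** * Weak learning from thresholds *)

Section Counting.
Variable R : realType.

Lemma count_below (J : nat) (y : R) : y <= J%:R -> y <= \sum_(j < J) (j%:R < y)%R%:R.
Proof.
elim: J => [|J IH] yJ; first by rewrite big_ord0.
rewrite big_ord_recr/=; have [yJ'|Jy] := leP y J%:R.
  by rewrite -[leLHS]addr0 lerD ?IH.
rewrite (eq_bigr (fun=> 1)) => [|j _]; first by rewrite sumr_const card_ord natr1.
by rewrite (lt_trans _ Jy)// ltr_nat.
Qed.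

Lemma count_above (J : nat) (y : R) : -1 <= y -> J%:R - y - 1 <= \sum_(j < J) (y < j%:R)%R%:R.
Proof.
move=> y1; elim: J => [|J IH]; first by rewrite big_ord0; lra.
rewrite big_ord_recr/=; have [Jy|yJ] := leP J%:R y.
  rewrite addr0 (@le_trans _ _ 0)//; first by rewrite -natr1; lra.
  by rewrite sumr_ge0.
by rewrite -[in leLHS]natr1 /= mulr1n; lra.
Qed.

End Counting.

Section Agreement.
Variables (R : realType) (X : choiceType).
Implicit Types (s b : X -> option R) (f sg : X -> R) (S B : set (X -> option R)).

(* Where the sign of [s - f] and the sign predicted by the twisted benchmark
   [- sg * b] coincide, their common value; undefined elsewhere.  A set shattered
   by such concepts is shattered by both thresholded classes. *)
Definition agree f (eta1 : R) sg (theta eta2 : R) s b : X -> option bool := fun x =>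
  match thr f eta1 s x, thr (fun=> theta) eta2 b x with
  | Some al, Some ta => if al == - sg x * ta then Some (al == 1) else None
  | _, _ => None
  end.

Definition agree_class S B f eta1 sg theta eta2 : set (X -> option bool) :=
  [set a | exists s b, [/\ S s, B b & a = agree f eta1 sg theta eta2 s b]].

Definition dual_vc_le S B (eta1 eta2 : R) (d : nat) :=
  forall (r : X -> R) (theta : R) (k : nat) (e : 'I_k -> X), injective e ->
    shattered (thr_class S r eta1) e -> shattered (thr_class B (fun=> theta) eta2) e ->
    (k <= d)%N.

Lemma thr_cases (r : X -> R) (eta : R) (h : X -> option R) x (v : R) :
  thr r eta h x = Some v -> v = 1 \/ v = -1.
Proof.
by rewrite /thr; case: (h x) => // u; case: ifP => [_ [<-]|_]; [left|case: ifP => // _ [<-]; right].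
Qed.

Lemma agree_some f eta1 sg theta eta2 s b x l : (sg x = 1 \/ sg x = -1) ->
  agree f eta1 sg theta eta2 s b x = Some l ->
  thr f eta1 s x = Some (sgnb R l) /\ thr (fun=> theta) eta2 b x = Some (- sg x * sgnb R l).
Proof.
move=> sgx; rewrite /agree.
case E1 : (thr f eta1 s x) => [al|]//; case E2 : (thr _ eta2 b x) => [ta|]//.
case: eqP => // alE [<-].
have n1 : (-1 == 1 :> R) = false by apply/eqP => h; have : (0 : R) < 1 := ltr01; lra.
have -> : sgnb R (al == 1) = al.
  by rewrite /sgnb; case: (thr_cases E1) => ->; rewrite ?eqxx ?n1.
split=> //; congr Some; rewrite alE; case: sgx => ->; ring.
Qed.

(** A label [l] of the concept at [x] forces the thresholded [s] to be [l] and the thresholded [b]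
    to be [- sg x * l]. The twist by [- sg] permutes the sign patterns, so both classes realise all
    of them. The current predictor [f] becomes the function [r] in the definition of [m], which
    explains the supremum over arbitrary [r]. *)
Lemma agree_vc S B f eta1 sg theta eta2 d : (forall x, sg x = 1 \/ sg x = -1) ->
  dual_vc_le S B eta1 eta2 d -> vc_le (agree_class S B f eta1 sg theta eta2) d.
Proof.
move=> sg1 Hd k e e_inj sh; apply: (Hd f theta k e e_inj).
  move=> xi; have [_ [s [b [Ss Bb ->]]] h] := sh xi.
  exists (thr f eta1 s); split; first by exists s.
  by move=> i; have [] := agree_some (sg1 _) (h i).
move=> xi; have [_ [s [b [Ss Bb ->]]] h] := sh (fun i => xi i (+) (sg (e i) == 1)).
exists (thr (fun=> theta) eta2 b); split; first by exists b.
move=> i; have [_ ->] := agree_some (sg1 _) (h i); congr Some.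
have n1 : (-1 == 1 :> R) = false by apply/eqP => h'; have : (0 : R) < 1 := ltr01; lra.
by case: (sg1 (e i)) => ->; rewrite ?eqxx ?n1 /sgnb; case: (xi i) => /=; ring.
Qed.

End Agreement.

Lemma gprod_norm_le (R : realType) (u : R) (o : option R) :
  (forall v, o = Some v -> -1 <= v <= 1) -> `|gprod u o| <= `|u|.
Proof.
case: o => [v /(_ v erefl)|_] /=; last by rewrite normrN normr_id.
by move=> h; rewrite normrM -[leRHS]mulr1 ler_wpM2l// ler_norml.
Qed.

Section Realizable.
Variables (R : realType) (X : choiceType) (mu : ddist R (X * R)) (s : X -> option R).
Hypothesis s_hyp : forall x v, s x = Some v -> -1 <= v <= 1.
Hypothesis s_real : realizable_by mu s.

Definition target x := odflt 0 (s x).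

Lemma target_bound x : -1 <= target x <= 1.
Proof.
rewrite /target; case E : (s x) => [v|]/=; first exact: s_hyp E.
by apply/andP; split; lra.
Qed.

Lemma label_bounded : bounded_ae mu 1 snd.
Proof. by move=> n wn; rewrite ler_norml; case: s_real => /(_ n wn). Qed.

Lemma bounded_fst (M : R) (phi : X -> R) : (forall x, `|phi x| <= M) ->
  bounded_ae mu M (fun p => phi p.1).
Proof. by move=> h n _; exact: h. Qed.

(** Realizability prescribes the conditional mean one [x] at a time, so the identity is proved on
    each fiber of the first projection. *)
Lemma tower (M : R) (phi : X -> R) : (forall x, `|phi x| <= M) ->
  E mu (fun p => phi p.1 * p.2) = E mu (fun p => phi p.1 * target p.1).
Proof.
move=> phiM; case: s_real => yb [sN sE].
have b1 : bounded_ae mu M (fun p => phi p.1 * p.2).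
  move=> n wn; rewrite normrM -[M]mulr1 ler_pM//; exact: label_bounded.
have b2 : bounded_ae mu M (fun p => phi p.1 * target p.1).
  move=> n wn; rewrite normrM -[M]mulr1 ler_pM// ler_norml; exact: target_bound.
apply: (fiber_eq (phi := fst) (D := setT) _ b1 b2) => // v _.
have bv : bounded_ae mu 1 (on_fiber fst v (@snd X R)).
  exact: on_fiber_bounded label_bounded.
have b1v : bounded_ae mu 1 (fun p : X * R => (asbool (p.1 = v))%:R).
  by move=> n wn; case: asbool; rewrite ?normr1 ?normr0.
case sv : (s v) => [u|]; last first.
  apply: eq_E => n wn; rewrite /on_fiber asboolF ?mul0r//= => e.
  by have := sN n wn; rewrite e sv.
have := sE v u sv; rewrite (ExE bv) (ExE b1v) -EFinM => -[e].
transitivity (phi v * E mu (on_fiber fst v snd)).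
  rewrite -(EZ _ bv); apply: eq_E => n _; rewrite /on_fiber.
  by case: asboolP => [->|_]; rewrite ?mul1r ?mul0r ?mulr0.
rewrite {}e -(EZ _ b1v) -(EZ _ (bounded_aeZ _ b1v)); apply: eq_E => n _; rewrite /on_fiber.
case: asboolP => [->|_]; rewrite ?mul1r ?mul0r ?mulr0 ?mulr1//.
by rewrite /target sv.
Qed.

Variables (f sg : X -> R) (b : X -> option R).
Hypothesis f_bound : forall x, -1 <= f x <= 1.
Hypothesis sg1 : forall x, sg x = 1 \/ sg x = -1.
Hypothesis b_hyp : forall x v, b x = Some v -> -1 <= v <= 1.

Let gap x := target x - f x.

Lemma gap_bound x : `|gap x| <= 2.
Proof.
by rewrite /gap ler_norml; have /andP[? ?] := target_bound x; have /andP[? ?] := f_bound x; lra.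
Qed.

Lemma sg_norm x : `|sg x| = 1.
Proof. by case: (sg1 x) => ->; rewrite ?normrN normr1. Qed.

Lemma gprod_bound u x : `|gprod u (b x)| <= `|u|.
Proof. exact: gprod_norm_le (@b_hyp x). Qed.

Lemma residual_bounded : bounded_ae mu 2 (fun p => p.2 - f p.1).
Proof.
move=> n wn; have := label_bounded wn; rewrite !ler_norml.
by have /andP[? ?] := f_bound (atom mu n).1; move=> /andP[? ?]; lra.
Qed.

(** Where [b] is undefined this is a conditional Jensen inequality for the absolute value. It is
    obtained by testing against the sign of the gap, which depends on [x] alone, so that [tower] can
    replace the label by [s]. *)
Lemma corr_le_target : E mu (fun p => gprod ((f p.1 - p.2) * sg p.1) (b p.1)) <=
  E mu (fun p => gprod (- gap p.1 * sg p.1) (b p.1)).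
Proof.
pose phi x := if b x is Some u then - sg x * u else - Num.sg (gap x).
have phi1 x : `|phi x| <= 1.
  rewrite /phi; case E : (b x) => [u|].
    by rewrite normrM normrN sg_norm mul1r ler_norml; exact: b_hyp E.
  by rewrite normrN normr_sg; case: eqP.
have f1 x : `|phi x * f x| <= 1.
  by rewrite normrM -[leRHS]mulr1 ler_pM// ler_norml.
have t1 x : `|phi x * target x| <= 1.
  by rewrite normrM -[leRHS]mulr1 ler_pM// ler_norml target_bound.
have by1 : bounded_ae mu 1 (fun p => phi p.1 * p.2).
  by move=> n wn; rewrite normrM -[leRHS]mulr1 ler_pM// label_bounded.
have -> : E mu (fun p => gprod (- gap p.1 * sg p.1) (b p.1)) =
    E mu (fun p => phi p.1 * p.2 - phi p.1 * f p.1).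
  rewrite (EB by1 (bounded_fst f1)) (tower phi1) -(EB (bounded_fst t1) (bounded_fst f1)).
  apply: eq_E => n _; rewrite -mulrBr -/(gap _) /phi /gprod.
  case: (b _) => [u|]; first by ring.
  by rewrite normrM normrN sg_norm mulr1 mulNr normrEsg.
apply: (@le_E _ _ _ 2 2).
- move=> n wn; apply: le_trans (gprod_bound _ _) _.
  by rewrite normrM sg_norm mulr1 distrC residual_bounded.
- move=> n wn; rewrite -mulrBr normrM -[leRHS]mul1r ler_pM//.
  exact: residual_bounded.
move=> n wn; rewrite -mulrBr /gprod /phi; case: (b _) => [u|].
  by rewrite le_eqVlt; apply/orP; left; apply/eqP; ring.
rewrite normrM sg_norm mulr1 mulNr lerN2 distrC.
apply: le_trans (ler_norm _) _; rewrite normrM normr_sg.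
by rewrite -[leRHS]mul1r ler_wpM2r//; case: (_ != _).
Qed.

Variables (eta1 eta2 : R) (J : nat).
Hypotheses (eta1_gt0 : 0 < eta1) (eta2_gt0 : 0 < eta2) (J_gt0 : (0 < J)%N).

Definition theta (j : nat) : R := -1 + 2 * j%:R / J%:R.

Let lab j := agree f eta1 sg (theta j) eta2 s b.

(** A lower bound for the correlation achieved by an error-free predictor of the concept: full gain
    where the concept has a label, full loss where it has none. *)
Let w j x := `|gap x| * (if lab j x is Some _ then 1 else -1).

Lemma w_bound j x : `|w j x| <= 2.
Proof.
rewrite /w normrM normr_id; case: (lab _ _) => [_|]; rewrite ?normrN normr1 mulr1; exact: gap_bound.
Qed.

(** A uniform threshold in [[-1,1]] lies below [u] with probability [(1 + u) / 2], so the sign of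
    [u - theta] has mean [u]: thresholding is unbiased. The margin and the grid bias it by at most
    [2 * eta2 + 2 / J], which the factor [|gap| <= 2] doubles. Where [|gap| <= eta1], the passage
    from [|gap|] to [- |gap|] costs at most [2 * eta1]. *)
Lemma threshold_average x : s x <> None ->
  gprod (- gap x * sg x) (b x) <=
  J%:R^-1 * \sum_(j < J) w j x + 2 * eta1 + 4 * eta2 + 4 / J%:R.
Proof.
move=> sx; have J0 : (0 : R) < J%:R by rewrite ltr0n.
have iJ0 : (0 : R) < J%:R^-1 by rewrite invr_gt0.
have g2 := gap_bound x; have g0 := normr_ge0 (gap x).
have e1 := eta1_gt0; have e2 := eta2_gt0.
have lo j : - `|gap x| <= w j x.
  by rewrite /w; case: (lab _ _) => [_|]; lra.
have avg_lo : - `|gap x| <= J%:R^-1 * \sum_(j < J) w j x.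
  rewrite mulrC ler_pdivlMr//; apply: le_trans (ler_sum _ (fun (j : 'I_J) _ => lo j)).
  by rewrite sumr_const card_ord mulr_natr.
have four : 0 <= 4 / J%:R :> R by rewrite divr_ge0// ltW.
rewrite /gprod; case bx : (b x) => [u|]; last by rewrite normrM normrN sg_norm mulr1; lra.
have /andP[u1 u2] := b_hyp bx.
have [small|big] := leP `|gap x| eta1.
  have : - gap x * sg x * u <= `|gap x|.
    apply: le_trans (ler_norm _) _; rewrite !normrM normrN sg_norm mulr1.
    by rewrite -[leRHS]mulr1 ler_wpM2l// ler_norml u1.
  by lra.
case sE : (s x) sx => [v|]// _.
have gE : gap x = v - f x by rewrite /gap /target sE.
pose al : R := Num.sg (gap x).
have g00 : 0 < `|gap x| by lra.
have gal : gap x = al * `|gap x| by rewrite /al -numEsg.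
have al1 : al = 1 \/ al = -1.
  rewrite /al; case: sgrP => g; [|by left|by right].
  by move: g00; rewrite g normr0 ltxx.
have thr_s : thr f eta1 s x = Some al.
  rewrite /thr sE; move: big gE; rewrite /al; case: sgrP => g; rewrite ?gtr0_norm ?ltr0_norm//.
  - by move: g00; rewrite g normr0 ltxx.
  - by move=> big gE; rewrite ifT//; lra.
  - by move=> big gE; rewrite ifF ?ifT//; [lra|apply/negbTE; rewrite -leNgt; lra].
pose a := - sg x * al.
have a1 : a = 1 \/ a = -1.
  by rewrite /a; case: (sg1 x) => ->; case: al1 => ->; rewrite ?opprK ?mulN1r ?mul1r ?opprK; auto.
have wE j : w j x = `|gap x| *
    (if thr (fun=> theta j) eta2 b x == Some a then 1 else -1).
  rewrite /w /lab /agree thr_s; congr (_ * _).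
  case: (thr _ _ _) => [ta|]//=; rewrite /a.
  have -> : (Some ta == Some (- sg x * al)) = (al == - sg x * ta).
    have K t c : t = - sg x * c -> c = - sg x * t by move=> ->; case: (sg1 x) => ->; ring.
    by apply/eqP/eqP => [[/K]|/K ->].
  by case: eqP.
pose cnt : R := \sum_(j < J) (thr (fun=> theta j) eta2 b x == Some a)%:R.
have sumE : \sum_(j < J) w j x = `|gap x| * (2 * cnt - J%:R).
  rewrite (eq_bigr (fun j : 'I_J => `|gap x| * (2 *
     (thr (fun=> theta j) eta2 b x == Some a)%:R - 1))).
    by rewrite -mulr_sumr; congr (_ * _); rewrite sumrB -mulr_sumr sumr_const card_ord.
  by move=> j _; rewrite wE; congr (_ * _); case: eqP => _ /=; lra.
have QE : - gap x * sg x * u = `|gap x| * (a * u).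
  by rewrite {1}gal /a; ring.
have JK : J%:R * J%:R^-1 = 1 :> R by rewrite mulfV ?gt_eqF.
have thetaE j : theta j * J%:R = - J%:R + 2 * j%:R.
  by rewrite /theta mulrDl mulN1r mulfVK ?gt_eqF.
have cnt_ge : (a * u - 2 * eta2) * J%:R - 2 <= 2 * cnt - J%:R.
  case: a1 => a1.
    have h := @count_below R J ((u - eta2 + 1) * J%:R / 2) _.
    have : (u - eta2 + 1) * J%:R / 2 <= cnt.
      apply: le_trans (h _) _; first by nra.
      apply: ler_sum => j _; rewrite ler_nat; case: ltP => //= hj.
      rewrite /thr bx ifT ?a1 ?eqxx//.
      have : (theta j + eta2) * J%:R < u * J%:R by rewrite mulrDl thetaE; lra.
      by rewrite ltr_pM2r.
    by rewrite a1; nra.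
  have h := @count_above R J ((u + eta2 + 1) * J%:R / 2) _.
  have : J%:R - (u + eta2 + 1) * J%:R / 2 - 1 <= cnt.
    apply: le_trans (h _) _; first by nra.
    apply: ler_sum => j _; rewrite ler_nat; case: ltP => //= hj.
    have hu : u * J%:R < (theta j - eta2) * J%:R by rewrite mulrBl thetaE; lra.
    rewrite ltr_pM2r// in hu.
    by rewrite /thr bx ifF ?ifT ?a1 ?eqxx//; apply/negbTE; rewrite -leNgt; lra.
  by rewrite a1; nra.
rewrite sumE QE.
have h2 : a * u - 2 * eta2 - 2 / J%:R <= J%:R^-1 * (2 * cnt - J%:R).
  have := cnt_ge; rewrite -(ler_pM2l iJ0); set z := 2 * cnt - _.
  apply: le_trans; rewrite le_eqVlt; apply/orP; left; apply/eqP.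
  by field; rewrite gt_eqF.
have : `|gap x| * (a * u - 2 * eta2 - 2 / J%:R) <= `|gap x| * (J%:R^-1 * (2 * cnt - J%:R)).
  by rewrite ler_wpM2l.
have : `|gap x| * (2 * eta2 + 2 / J%:R) <= 2 * (2 * eta2 + 2 / J%:R).
  by rewrite ler_wpM2r// addr_ge0 ?divr_ge0// mulr_ge0// ltW.
by lra.
Qed.

Lemma exists_threshold : exists j : 'I_J,
  E mu (fun p => gprod ((f p.1 - p.2) * sg p.1) (b p.1)) - 2 * eta1 - 4 * eta2 - 4 / J%:R
  <= E mu (fun p => w j p.1).
Proof.
set V := E mu _; have J0 : (0 : R) < J%:R by rewrite ltr0n.
have bw (j : 'I_J) : bounded_ae mu 2 (fun p => w j p.1) by apply: bounded_fst; exact: w_bound.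
have [Es [M bs]] := E_sum (index_enum 'I_J) bw.
have bQ : bounded_ae mu 2 (fun p => gprod (- gap p.1 * sg p.1) (b p.1)).
  apply: (@bounded_fst 2 (fun x => gprod (- gap x * sg x) (b x))) => x.
  by apply: le_trans (gprod_bound _ _) _; rewrite normrM normrN sg_norm mulr1 gap_bound.
have bsum := bounded_aeD (bounded_aeZ J%:R^-1 bs)
  (bounded_ae_cst (mu := mu) (2 * eta1 + 4 * eta2 + 4 / J%:R)).
have h : V <= J%:R^-1 * \sum_(j < J) E mu (fun p => w j p.1) + (2 * eta1 + 4 * eta2 + 4 / J%:R).
  apply: le_trans corr_le_target _.
  rewrite -Es -(EZ _ bs) -[X in _ + X](E_cst mu) -(ED (bounded_aeZ _ bs) (bounded_ae_cst _)).
  apply: (le_E bQ bsum) => n wn /=.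
  have := @threshold_average (atom mu n).1; rewrite -!addrA; apply.
  by case: s_real => _ [/(_ n wn)].
apply: contrapT => /forallNP hj.
have : \sum_(j < J) E mu (fun p => w j p.1) < \sum_(j < J) (V - 2 * eta1 - 4 * eta2 - 4 / J%:R).
  apply: ltr_sum => [|j _]; first by apply/hasP; exists (Ordinal J_gt0); rewrite ?mem_index_enum.
  by rewrite ltNge; apply/negP; exact: hj.
rewrite sumr_const card_ord -[ltRHS]mulr_natl -ltr_pdivrMl//.
by lra.
Qed.

Definition sgnh (h : X -> bool) x : R := sgnb R (h x).

Lemma sgnh_norm h x : `|sgnh h x| = 1.
Proof. by rewrite /sgnh /sgnb; case: (h x); rewrite ?normrN normr1. Qed.

(** Pointwise, a mistake turns [|gap|] into [- |gap|], a loss of at most 4 because [|gap| <= 2];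
    where the concept has no label, [- |gap|] bounds any prediction from below. *)
Lemma corr_ge (h : X -> bool) (j : nat) :
  E mu (fun p => w j p.1)
   - 4 * E mu (fun p => ((lab j p.1 != None) && (Some (h p.1) != lab j p.1))%:R)
  <= E mu (fun p => (p.2 - f p.1) * sgnh h p.1).
Proof.
pose err x : R := ((lab j x != None) && (Some (h x) != lab j x))%:R.
have berr : bounded_ae mu 1 (fun p => err p.1).
  by apply: bounded_fst => x; rewrite /err; case: (_ && _); rewrite ?normr1 ?normr0.
have bw : bounded_ae mu 2 (fun p => w j p.1) by apply: bounded_fst; exact: w_bound.
have s1 x : `|sgnh h x| <= 1 by rewrite sgnh_norm.
have f1 x : `|sgnh h x * f x| <= 1.
  by rewrite normrM -[leRHS]mulr1 ler_pM// ler_norml.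
have t1 x : `|sgnh h x * target x| <= 1.
  by rewrite normrM -[leRHS]mulr1 ler_pM// ler_norml target_bound.
have by1 : bounded_ae mu 1 (fun p => sgnh h p.1 * p.2).
  by move=> n wn; rewrite normrM -[leRHS]mulr1 ler_pM// label_bounded.
have -> : E mu (fun p => (p.2 - f p.1) * sgnh h p.1) =
    E mu (fun p => sgnh h p.1 * target p.1 - sgnh h p.1 * f p.1).
  rewrite (EB (bounded_fst t1) (bounded_fst f1)) -(tower s1) -(EB by1 (bounded_fst f1)).
  by apply: eq_E => n _; ring.
rewrite -(EZ 4 berr) -(EB bw (bounded_aeZ 4 berr)).
apply: (le_E (bounded_aeD bw (bounded_aeN (bounded_aeZ 4 berr)))
  (bounded_aeD (bounded_fst t1) (bounded_aeN (bounded_fst f1)))) => n wn /=.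
set x := (atom mu n).1; rewrite -mulrBr -/(gap x).
have g2 := gap_bound x; have gn := ler_norm (gap x).
have gm : - gap x <= `|gap x| by rewrite -normrN ler_norm.
have sx : s x <> None by case: s_real => _ [/(_ n wn)].
rewrite /w /err /sgnh; case E1 : (lab j x) => [l|]/=; last first.
  by rewrite /sgnb; case: (h x); lra.
have [ts _] := agree_some (sg1 x) E1.
case: eqP => [[->]|_] /=; last by rewrite /sgnb; case: (h x); lra.
suff -> : sgnb R l * gap x = `|gap x| by lra.
have e1 := eta1_gt0.
move: ts; rewrite /thr /gap /target; case: (s x) => [v|]//=.
have n1 : (1 = -1 :> R) -> False by move=> h'; have : (0 : R) < 1 := ltr01; lra.
rewrite /sgnb; case: ifP => [hv|_].
  by case: l {E1} => [_|[/n1]//]; rewrite mul1r gtr0_norm//; lra.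
case: ifP => // hv; case: l {E1} => [[/esym/n1]//|_].
by rewrite mulN1r ltr0_norm//; lra.
Qed.

Lemma weak_learning : exists j : 'I_J, forall h : X -> bool,
  E mu (fun p => gprod ((f p.1 - p.2) * sg p.1) (b p.1)) - 2 * eta1 - 4 * eta2 - 4 / J%:R
   - 4 * E mu (fun p => ((lab j p.1 != None) && (Some (h p.1) != lab j p.1))%:R)
  <= E mu (fun p => (p.2 - f p.1) * sgnh h p.1).
Proof.
have [j jP] := exists_threshold; exists j => h; apply: le_trans (corr_ge h j).
by rewrite lerD2r.
Qed.

End Realizable.

(** * Multiaccuracy and multicalibration errors *)

Section Errors.
Variables (R : realType) (X : Type) (mu : ddist R (X * R)).
Hypothesis label_le1 : bounded_ae mu 1 snd.
Implicit Types (f : X -> R) (b : X -> option R) (B : set (X -> option R)).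

Definition signs (zeta : R -> R) := forall v, zeta v = 1 \/ zeta v = -1.

Definition signed_corr f b (zeta : R -> R) : R :=
  E mu (fun p => gprod ((f p.1 - p.2) * zeta (f p.1)) (b p.1)).

(** Choosing at every level the sign that attains the inner supremum merges the sum over levels into
    one expectation, twisted by a sign that depends on [f x] only. This is the twist [sg] of the
    weak learning step. *)
Lemma MC_term f b : (forall x, -1 <= f x <= 1) ->
  (forall x v, b x = Some v -> -1 <= v <= 1) ->
  exists zeta, [/\ signs zeta,
    ssum (range f) (fun v => ereal_sup [set u | exists sigma, (sigma = 1 \/ sigma = -1) /\
      u = Ex mu (fun p => gprod ((f p.1 - p.2) * (asbool (f p.1 = v))%:R * sigma) (b p.1))])
    = (signed_corr f b zeta)%:E &
    forall zeta', signs zeta' -> signed_corr f b zeta' <= signed_corr f b zeta].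
Proof.
move=> f1 b1; pose g (zeta : R -> R) (p : X * R) := gprod ((f p.1 - p.2) * zeta (f p.1)) (b p.1).
have sgn1 zeta v : signs zeta -> `|zeta v| = 1.
  by move=> h; case: (h v) => ->; rewrite ?normrN normr1.
have gb zeta : signs zeta -> bounded_ae mu 2 (g zeta).
  move=> sz n wn; apply: le_trans (gprod_norm_le _ (b1 _)) _.
  rewrite normrM (sgn1 zeta)// mulr1; have := label_le1 wn; rewrite !ler_norml.
  by have /andP[? ?] := f1 (atom mu n).1; move=> /andP[? ?]; lra.
have s_cst sigma : sigma = 1 \/ sigma = -1 -> signs (fun=> sigma) by move=> h v.
have fD (p : X * R) : range f (f p.1) by exists p.1.
pose u sigma v := E mu (on_fiber (fun p : X * R => f p.1) v (g (fun=> sigma))).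
have uE sigma v : sigma = 1 \/ sigma = -1 ->
    Ex mu (fun p => gprod ((f p.1 - p.2) * (asbool (f p.1 = v))%:R * sigma) (b p.1)) = (u sigma v)%:E.
  move=> hs; rewrite /u -(ExE (on_fiber_bounded _ v (gb _ (s_cst _ hs)))).
  congr Ex; apply/funext => p; rewrite /on_fiber /g.
  case: asboolP => _ /=; rewrite ?mulr1 ?mul1r// mulr0 !mul0r /gprod.
  by case: (b _) => [c|]; rewrite ?mul0r ?normr0 ?oppr0.
pose zeta v := if u (-1) v <= u 1 v then 1 else -1 : R.
have sz : signs zeta by move=> v; rewrite /zeta; case: ifP; [left|right].
have fE zeta' v : on_fiber (fun p : X * R => f p.1) v (g zeta') =
    on_fiber (fun p : X * R => f p.1) v (g (fun=> zeta' v)).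
  by apply/funext => p; rewrite /on_fiber /g; case: asboolP => [->//|_]; rewrite !mul0r.
have umax sigma v : sigma = 1 \/ sigma = -1 -> u sigma v <= u (zeta v) v.
  by rewrite /zeta; case: ifP => h [->|->] //; move/negbT: h; rewrite -ltNge => /ltW.
exists zeta; split=> //.
- rewrite -(ssum_fibers fD (gb _ sz)); congr ssum; apply/funext => v.
  rewrite fE -/(u _ _); apply/le_anti/andP; split.
    by apply: ge_ereal_sup => _ [sigma [hs ->]]; rewrite uE// lee_fin umax.
  apply: ereal_sup_ubound; exists (zeta v); split; first exact: sz.
  by rewrite uE//; exact: sz.
- move=> zeta' sz'; apply: (fiber_le fD (gb _ sz') (gb _ sz)) => v _.
  by rewrite (fE zeta') (fE zeta); exact: (umax (zeta' v) v (sz' v)).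
Qed.

Lemma MCerr_le f B (eps : R) : (forall x, -1 <= f x <= 1) -> hyp_class B ->
  (forall b zeta, B b -> signs zeta -> signed_corr f b zeta <= eps) ->
  (MCerr mu B f <= eps%:E)%E.
Proof.
move=> f1 hB h; apply: ge_ereal_sup => _ [b [Bb ->]].
have [zeta [sz -> _]] := MC_term f1 (hB _ Bb).
by rewrite lee_fin h.
Qed.

Lemma MAerr_le_MCerr f B : (forall x, -1 <= f x <= 1) -> hyp_class B ->
  (MAerr mu B f <= MCerr mu B f)%E.
Proof.
move=> f1 hB; apply: ge_ereal_sup => _ [b [sigma [Bb [hs ->]]]].
have [zeta [sz e zmax]] := MC_term f1 (hB _ Bb).
apply: le_trans (ereal_sup_ubound _); last by exists b; split; [exact: Bb|reflexivity].
rewrite e.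
have gb : bounded_ae mu 2 (fun p => gprod ((f p.1 - p.2) * sigma) (b p.1)).
  move=> n wn; apply: le_trans (gprod_norm_le _ (hB _ Bb _)) _.
  have -> : `|(f (atom mu n).1 - (atom mu n).2) * sigma| = `|f (atom mu n).1 - (atom mu n).2|.
    by rewrite normrM; case: hs => ->; rewrite ?normrN normr1 mulr1.
  have := label_le1 wn; rewrite !ler_norml.
  by have /andP[? ?] := f1 (atom mu n).1; move=> /andP[? ?]; lra.
by rewrite (ExE gb) lee_fin; apply: (zmax (fun=> sigma)).
Qed.

End Errors.

(** * Comparing sample complexities and dimensions *)

Section Comparisons.
Variables (R : realType) (X : Type) (S B : set (X -> option R)).
Hypothesis B_hyp : hyp_class B.

Lemma le_Pn (T : Type) (mu : ddist R T) n (P Q : ('I_n -> T) -> Prop) :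
  (forall w, P w -> Q w) -> (Pn mu P <= Pn mu Q)%E.
Proof.
move=> PQ; apply: le_esum => i _; rewrite lee_fin ler_wpM2l ?prodr_ge0//.
  by move=> k _; exact: wt_ge0.
by rewrite ler_nat; case: asboolP => //= /PQ h; rewrite asboolT.
Qed.

Lemma numMA_le_numMC eps delta : (numMA S B eps delta <= numMC S B eps delta)%E.
Proof.
apply: le_ereal_inf => _ [n [L [Lb [_ LP]]] <-]; exists n => //; exists L; split=> //.
move=> mu [s [Ss sr]]; apply: le_trans (LP mu _) _; first by exists s.
apply: le_Pn => w; apply: le_trans; apply: MAerr_le_MCerr => //.
by move=> k wk; rewrite ler_norml; case: sr => /(_ k wk).
Qed.

Lemma thr_shattered_fat (H : set (X -> option R)) r eta k (e : 'I_k -> X) :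
  shattered (thr_class H r eta) e -> fat_shattered H eta e.
Proof.
move=> sh; exists (r \o e) => xi; have [_ [[h Hh <-] hx]] := sh xi.
exists h; split=> // i; have := hx i; rewrite /thr /sgnb /=; case: (h (e i)) => [v|]//.
have n1 : (1 = -1 :> R) -> False by move=> h'; have : (0 : R) < 1 := ltr01; lra.
case: ifP => [hv [E]|_].
  by exists v; split=> //; case: (xi i) E => [_|/n1//]; lra.
case: ifP => // hv [E].
by exists v; split=> //; case: (xi i) E => [/esym/n1//|_]; lra.
Qed.

Lemma mdim_le_fat2 eta : (mdim S B eta eta <= fat2 eta S B)%E.
Proof.
apply: ge_ereal_sup => _ [r [theta ->]]; apply: le_ereal_sup => v [->|]; first by left.
move=> [k [e [ei [s1 s2]]] <-]; right; exists k => //; exists e; split=> //.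
by split; apply: thr_shattered_fat.
Qed.

Lemma mdim_ge0 (eta1 eta2 m : R) :
  mdim S B eta1 eta2 = m%:E -> 0 <= m.
Proof.
move=> mE; rewrite -lee_fin -mE; apply: le_trans (ereal_sup_ubound _); last first.
  by exists (fun=> 0), 0; reflexivity.
by apply: ereal_sup_ubound; left.
Qed.

Lemma mdim_dual_vc eta1 eta2 (m : R) : mdim S B eta1 eta2 = m%:E ->
  exists d : nat, d%:R <= m /\ forall (r : X -> R) (theta : R) (k : nat) (e : 'I_k -> X),
    injective e -> shattered (thr_class S r eta1) e ->
    shattered (thr_class B (fun=> theta) eta2) e -> (k <= d)%N.
Proof.
(* Shattered sets have integer size, so rounding [m] down loses nothing. *)
move=> mE; exists (Num.truncn m).
have m0 := mdim_ge0 mE.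
split; first by rewrite truncn_le.
move=> r theta k e ei s1 s2; rewrite truncn_ge_nat// -lee_fin -mE.
apply: le_trans (ereal_sup_ubound _); last by exists r, theta; reflexivity.
by apply: ereal_sup_ubound; right; exists k => //; exists e.
Qed.

End Comparisons.

(** * The boosting learner *)

Section Learner.
Variables (R : realType) (X : choiceType) (S B : set (X -> option R)) (eta1 eta2 : R).
Variables (d q N : nat).
Variable P : set (X -> option bool) -> (X -> option bool) -> X -> bool.

(** A training set of this size leaves a fraction of mistakes below [1 / (64 q)]. The grid makes the
    rounding term [4 / J] equal to [1 / (8 q)]. Levels are [1 / (4 q)] apart, the size of one
    update. Each round lowers the squared loss, at most 1 initially, by [1 / (8 q ^ 2)]. *)
Definition train_size := (128 * d * q)%N.
Definition grid_size := (32 * q)%N.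
Definition top_level := (8 * q)%N.
Definition rounds := (8 * q * q).+1.

(* One boosting round: sample indices with guessed labels forming a training set,
   the index of a threshold, and a sign for every level of the current predictor. *)
Definition step := ({ffun 'I_train_size -> 'I_N} * {ffun 'I_train_size -> option bool} *
  'I_grid_size * {ffun 'I_top_level.+1 -> bool})%type.

Implicit Types (w : 'I_N -> X * R) (st : step) (c : seq step) (phi : X -> 'I_top_level.+1).

Definition idx st := st.1.1.1.
Definition guess st := st.1.1.2.
Definition threshold st := theta R grid_size st.1.2.

Definition value (l : 'I_top_level.+1) : R := (l%:R - (4 * q)%:R) / (4 * q)%:R.
Definition level_sign (tau : 'I_top_level.+1 -> bool) phi x := sgnb R (tau (phi x)).

Definition training_data w st : X -> option bool := fun x =>
  if [pick l | (w (idx st l)).1 == x] is Some l then guess st l else None.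

Definition weak_hyp w phi st : X -> bool :=
  P (agree_class S B (fun x => value (phi x)) eta1 (level_sign st.2 phi) (threshold st) eta2)
    (training_data w st).

Definition shift_level phi (h : X -> bool) : X -> 'I_top_level.+1 := fun x =>
  inord (if h x then minn (phi x).+1 top_level else (phi x).-1).

(** The newest step stands at the head of [c]; the starting level [4 q] has value 0. *)
Definition levels w c : X -> 'I_top_level.+1 :=
  foldr (fun st phi => shift_level phi (weak_hyp w phi st)) (fun=> inord (4 * q)) c.

Definition predictor w c x := value (levels w c x).

Definition corr_fun w phi st (p : X * R) : R :=
  (p.2 - value (phi p.1)) * sgnh R (weak_hyp w phi st) p.1.

Definition stops w c := forall st,
  \sum_(k < N) corr_fun w (levels w c) st (w k) <= N%:R / (2 * q)%:R.

(** No loop is run: any short sequence without an acceptable continuation will do, and [xget] picks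
    one. The default [[::]] stands for the case that none exists, which [exists_stop] excludes on
    representative samples. *)
Definition boost : learner R X N := fun w =>
  predictor w (xget [::] [set c | (size c <= rounds)%N /\ stops w c]).

Hypothesis q_gt0 : (0 < q)%N.

Let q4_gt0 : (0 : R) < (4 * q)%:R. Proof. by rewrite ltr0n muln_gt0. Qed.

Lemma value_bound l : -1 <= value l <= 1.
Proof.
have l8 : (l%:R : R) <= 2 * (4 * q)%:R.
  by rewrite -natrM ler_nat mulnA -ltnS.
rewrite /value ler_pdivlMr// ler_pdivrMr// mul1r mulN1r.
by have := ler0n R l; have := q4_gt0; move=> *; apply/andP; split; lra.
Qed.

Lemma training_data_ext w w' st : (forall l, w (idx st l) = w' (idx st l)) ->
  training_data w st = training_data w' st.
Proof.
move=> ww'; apply/funext => x; rewrite /training_data.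
by under eq_pick do rewrite ww'.
Qed.

Definition used_indices c : {set 'I_N} :=
  [set k in flatten [seq codom (idx st) | st <- c]]%SET.

Lemma used_indices_card c : (#|used_indices c| <= size c * train_size)%N.
Proof.
rewrite cardsE; apply: leq_trans (card_size _) _.
elim: c => //= st c IH; rewrite size_cat size_codom card_ord mulSn.
by rewrite leq_add2l.
Qed.

Lemma idx_used c st l : st \in c -> idx st l \in used_indices c.
Proof.
move=> stc; rewrite inE; apply/flattenP; exists (codom (idx st)); last exact: codom_f.
by apply/mapP; exists st.
Qed.

Lemma levels_ext w w' c : (forall k, k \in used_indices c -> w k = w' k) ->
  levels w c = levels w' c.
Proof.
elim: c => //= st c IH ww'.
rewrite IH => [|k]; last first.
  by rewrite inE => kc; apply: ww'; rewrite inE/= mem_cat kc orbT.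
congr shift_level; rewrite /weak_hyp; congr P; apply: training_data_ext => l.
by apply: ww'; apply: idx_used; rewrite mem_head.
Qed.

Lemma predictor_bound w c x : -1 <= predictor w c x <= 1.
Proof. exact: value_bound. Qed.

Lemma boost_finite_range w : finite_set (range (boost w)).
Proof.
apply: (@sub_finite_set _ _ (value @` [set: 'I_top_level.+1])).
  by move=> _ [x _ <-]; rewrite /boost /predictor; eexists.
by apply: finite_image; exact: finite_finset.
Qed.

(* Clipping to [-1,1] can only help, as the target lies in this interval. *)
Lemma shift_level_sqr_le phi (h : X -> bool) x (t : R) : -1 <= t <= 1 ->
  (t - value (shift_level phi h x)) ^+ 2 <=
  (t - value (phi x)) ^+ 2 - 2 / (4 * q)%:R * ((t - value (phi x)) * sgnh R h x)
    + ((4 * q)%:R ^-1) ^+ 2.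
Proof.
move=> /andP[t1 t2]; set Q := (4 * q)%:R : R; have Q0 : 0 < Q by exact: q4_gt0.
have QV : Q * Q^-1 = 1 by rewrite mulfV ?gt_eqF.
have iQ0 : 0 < Q^-1 by rewrite invr_gt0.
have topE : top_level%:R = 2 * Q by rewrite /Q /top_level -natrM mulnA.
rewrite /sgnh /sgnb /shift_level /value -/Q; clearbody Q; case: (h x).
  have [lt|ge] := ltnP (phi x) top_level.
    have -> : minn (phi x).+1 top_level = (phi x).+1 by apply/minn_idPl.
    rewrite inordK// -[(phi x).+1%:R]natr1; set l := (phi x)%:R.
    by rewrite le_eqVlt; apply/orP; left; apply/eqP; field; rewrite gt_eqF.
  have e : (phi x : nat) = top_level by apply/eqP; rewrite eqn_leq ge -ltnS ltn_ord.
  rewrite e; have -> : minn top_level.+1 top_level = top_level by apply/minn_idPr.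
  rewrite inordK// topE; have -> : (2 * Q - Q) / Q = 1 by field; rewrite gt_eqF.
  rewrite -subr_ge0.
  have -> : (t - 1) ^+ 2 - 2 / Q * ((t - 1) * 1) + Q^-1 ^+ 2 - (t - 1) ^+ 2 =
     2 * (Q^-1 * (1 - t)) + Q^-1 ^+ 2 by ring.
  by rewrite addr_ge0 ?sqr_ge0// mulr_ge0// mulr_ge0//; [exact: ltW|lra].
have [gt|le0] := ltnP 0 (phi x).
  have pl : ((phi x).-1 < top_level.+1)%N by rewrite (leq_ltn_trans (leq_pred _)).
  rewrite inordK//.
  have -> : (phi x).-1%:R = (phi x)%:R - 1 :> R by rewrite -[in RHS](prednK gt) -[in RHS]natr1 addrK.
  set l := (phi x)%:R.
  by rewrite le_eqVlt; apply/orP; left; apply/eqP; field; rewrite gt_eqF.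
have e : (phi x : nat) = 0%N by apply/eqP; rewrite -leqn0.
rewrite e inordK//; have -> : (0%:R - Q) / Q = -1 by rewrite sub0r mulNr mulfV ?gt_eqF.
rewrite -subr_ge0.
have -> : (t - -1) ^+ 2 - 2 / Q * ((t - -1) * -1) + Q^-1 ^+ 2 - (t - -1) ^+ 2 =
   2 * (Q^-1 * (1 + t)) + Q^-1 ^+ 2 by ring.
by rewrite addr_ge0 ?sqr_ge0// mulr_ge0// mulr_ge0//; [exact: ltW|lra].
Qed.

End Learner.

(** * Correctness on representative samples *)

Section Analysis.
Variables (R : realType) (X : choiceType) (S B : set (X -> option R)) (eta1 eta2 : R).
Variables (d q N : nat).
Variable P : set (X -> option bool) -> (X -> option bool) -> X -> bool.
Hypotheses (S_hyp : hyp_class S) (B_hyp : hyp_class B).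
Hypotheses (eta1_gt0 : 0 < eta1) (eta2_gt0 : 0 < eta2).
Hypothesis dual_vc : dual_vc_le S B eta1 eta2 d.
Hypotheses (q_gt0 : (0 < q)%N) (N_gt0 : (0 < N)%N).
Hypothesis P_spec : forall A, vc_le A d ->
  (forall g x l, g x = Some l -> P A g x = l) /\
  forall a ys, A a -> uniq ys -> (forall x, x \in ys -> a x <> None) ->
    (count (fun x => Some (P A (restr a [pred z | (z \in ys) && (z != x)]) x) != a x) ys
       <= 2 * d)%N.

Variables (mu : ddist R (X * R)) (s : X -> option R).
Hypotheses (Ss : S s) (s_real : realizable_by mu s).

Notation level := ('I_(top_level q).+1).
Notation round := (step d q N).
Implicit Types (w : 'I_N -> X * R) (st : round) (c : seq round) (phi : X -> level)
  (tau : level -> bool) (b : X -> option R).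

Let s_hyp x v : s x = Some v -> -1 <= v <= 1. Proof. exact: S_hyp. Qed.

Definition violates phi tau b := B b /\ q%:R^-1 + 2 * eta1 + 4 * eta2 <
  E mu (fun p => gprod ((value R (phi p.1) - p.2) * level_sign R tau phi p.1) (b p.1)).

(** One violating benchmark is fixed for each level function and sign pattern, so that the concepts
    to be tested are determined by descriptions and no element of [B] enters the union bound. *)
Definition adversary phi tau : X -> option R :=
  if pselect (exists b, violates phi tau b) is left h then projT1 (cid h) else fun=> None.

Lemma adversary_hyp phi tau x v : adversary phi tau x = Some v -> -1 <= v <= 1.
Proof.
rewrite /adversary; case: pselect => // h; have [Bb _] := projT2 (cid h); exact: B_hyp.
Qed.

Lemma adversary_spec phi tau b : violates phi tau b -> violates phi tau (adversary phi tau).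
Proof.
move=> vb; rewrite /adversary; case: pselect => [h|[]]; last by exists b.
exact: projT2 (cid h).
Qed.

Definition concept phi tau (theta0 : R) : X -> option bool :=
  agree (fun x => value R (phi x)) eta1 (level_sign R tau phi) theta0 eta2 s
    (adversary phi tau).

Definition mistake (a : X -> option bool) (h : X -> bool) (x : X) : bool :=
  (a x != None) && (Some (h x) != a x).

Let weak w phi st := weak_hyp S B eta1 eta2 P w phi st.
Let lev w c := levels S B eta1 eta2 P w c.

(** Deviations are controlled on one side only, so the correlation enters with both signs: kind 0
    shows that stopping is sound, kind 1 that accepted steps make progress, and the last kind bounds
    the mistakes of a trained hypothesis. *)
Definition test_fun w phi st (kind : nat) (p : X * R) : R :=
  match kind with
  | 0 => corr_fun S B eta1 eta2 P w phi st p
  | 1 => - corr_fun S B eta1 eta2 P w phi st p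
  | _ => (mistake (concept phi st.2 (threshold R st)) (weak w phi st) p.1)%:R
  end.

(** The fixed tuple length keeps the type finite: the head is the step under test, the tail lists
    the earlier steps followed by padding, and the first index tells how many of them count. *)
Definition description := ('I_(rounds q).+1 * (rounds q).+1.-tuple round * 'I_3)%type.

Definition described (e : description) w : X * R -> R :=
  test_fun w (lev w (take e.1.1 (behead e.1.2))) (thead e.1.2) e.2.

Definition tolerance : R := (64 * q)%:R^-1.

Definition representative w := forall e : description,
  N%:R * E mu (described e w) - \sum_(k < N) described e w (w k) <= tolerance * N%:R.

Lemma level_sign1 tau phi x : level_sign R tau phi x = 1 \/ level_sign R tau phi x = -1.
Proof. by rewrite /level_sign /sgnb; case: (tau _); [left|right]. Qed.

Lemma corr_fun_bounded w phi st : bounded_ae mu 2 (corr_fun S B eta1 eta2 P w phi st).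
Proof.
move=> n wn; rewrite normrM sgnh_norm mulr1.
by apply: (residual_bounded s_real (f := fun x => value R (phi x)) _ wn) => x; exact: value_bound.
Qed.

Lemma described_bounded e w : bounded_ae mu 2 (described e w).
Proof.
rewrite /described /test_fun; case: (e.2 : nat) => [|[|k]].
- exact: corr_fun_bounded.
- exact: bounded_aeN (corr_fun_bounded _ _ _).
- by move=> n _; case: mistake; rewrite ?normr1 ?normr0 ?ler1n.
Qed.

Definition description_indices (e : description) : {set 'I_N} := used_indices (val e.1.2).

Lemma description_indices_card e :
  (#|description_indices e| <= (rounds q).+1 * train_size d q)%N.
Proof. by apply: leq_trans (used_indices_card _) _; rewrite size_tuple. Qed.

Lemma described_ext e w w' : (forall k, k \in description_indices e -> w k = w' k) ->
  described e w = described e w'.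
Proof.
move=> ww'; rewrite /described.
have hd : thead e.1.2 \in (e.1.2 : seq round) by case/tupleP: (e.1.2) => x t; rewrite theadE mem_head.
have levE : lev w (take e.1.1 (behead e.1.2)) = lev w' (take e.1.1 (behead e.1.2)).
  apply: levels_ext => k; rewrite inE => /flattenP[_ /mapP[st stc ->] kst].
  apply: ww'; rewrite inE; apply/flattenP; exists (codom (idx st)) => //.
  by apply: map_f; apply: mem_behead; apply: mem_take stc.
have dataE : training_data w (thead e.1.2) = training_data w' (thead e.1.2).
  by apply: training_data_ext => l; apply: ww'; apply: idx_used.
apply/funext => p; rewrite levE /test_fun /corr_fun /weak /weak_hyp dataE //.
Qed.

Lemma representative_at w c st kind : representative w -> (size c <= rounds q)%N -> (kind < 3)%N ->
  N%:R * E mu (test_fun w (lev w c) st kind) - \sum_(k < N) test_fun w (lev w c) st kind (w k)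
    <= tolerance * N%:R.
Proof.
move=> good sc k3.
have sz : size (st :: c ++ nseq (rounds q - size c) st) == (rounds q).+1.
  by rewrite /= size_cat size_nseq subnKC.
have tc : (size c < (rounds q).+1)%N by rewrite ltnS.
have := good (Ordinal tc, Tuple sz, Ordinal k3).
by rewrite /described /= take_size_cat.
Qed.

Let Q0 : (0 : R) < q%:R. Proof. by rewrite ltr0n. Qed.
Let N0 : (0 : R) < N%:R. Proof. by rewrite ltr0n. Qed.

Let loss w c := E mu (fun p => (target s p.1 - value R (lev w c p.1)) ^+ 2).

Lemma gap_le2 phi x : `|target s x - value R (phi x)| <= 2.
Proof.
have /andP[? ?] := target_bound s_hyp x; have /andP[? ?] := value_bound R q_gt0 (phi x).
by rewrite ler_norml; apply/andP; split; lra.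
Qed.

Lemma sqr_gap_bounded phi : bounded_ae mu 4 (fun p => (target s p.1 - value R (phi p.1)) ^+ 2).
Proof.
apply: (bounded_fst (phi := fun x => (target s x - value R (phi x)) ^+ 2)) => x.
by rewrite normrX; have := gap_le2 phi x; have := normr_ge0 (target s x - value R (phi x)); nra.
Qed.

Lemma E_corr_fun w phi st : E mu (corr_fun S B eta1 eta2 P w phi st) =
  E mu (fun p => (target s p.1 - value R (phi p.1)) * sgnh R (weak w phi st) p.1).
Proof.
pose h := sgnh R (weak w phi st).
have h1 x : `|h x| <= 1 by rewrite /h sgnh_norm.
have v1 x : `|value R (phi x)| <= 1 by rewrite ler_norml value_bound.
have f1 x : `|h x * value R (phi x)| <= 1.
  by rewrite normrM -[leRHS]mulr1 ler_pM.
have t1 x : `|h x * target s x| <= 1.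
  by rewrite normrM -[leRHS]mulr1 ler_pM// ler_norml target_bound.
have by1 : bounded_ae mu 1 (fun p => h p.1 * p.2).
  by move=> n wn; rewrite normrM -[leRHS]mulr1 ler_pM// (label_bounded s_real).
transitivity (E mu (fun p => h p.1 * p.2 - h p.1 * value R (phi p.1))).
  by apply: eq_E => n _; rewrite /corr_fun -/(h _) -/(weak w phi st) -/h; ring.
rewrite (EB by1 (bounded_fst f1)) (tower s_hyp s_real h1) -(EB (bounded_fst t1) (bounded_fst f1)).
by apply: eq_E => n _; rewrite -/h; ring.
Qed.

Lemma loss_drop w c st : representative w -> (size c <= rounds q)%N ->
  N%:R / (2 * q)%:R < \sum_(k < N) corr_fun S B eta1 eta2 P w (lev w c) st (w k) ->
  loss w (st :: c) <= loss w c - ((8 * q * q)%:R)^-1.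
Proof.
move=> good sc emp; set phi := lev w c.
have tol := @representative_at w c st 1 good sc isT.
have cb := corr_fun_bounded w phi st.
rewrite /= in tol; rewrite (EN cb) sumrN opprK in tol.
set C := E mu _ in tol.
have C_ge : 3 / 8 / q%:R <= C.
  have h : N%:R / (2 * q)%:R - N%:R * C <= tolerance * N%:R by move: emp tol; rewrite -/phi; lra.
  rewrite -(ler_pM2l N0); move: h; rewrite /tolerance !natrM; set nn := N%:R; set qq := q%:R : R.
  have iq : 0 < qq^-1 by rewrite invr_gt0.
  rewrite !invfM; have : 0 < nn * qq^-1 by rewrite mulr_gt0.
  set z := nn / qq => z0.
  have -> : nn * (2^-1 * qq^-1) = z / 2 by rewrite /z; ring.
  have -> : 64^-1 * qq^-1 * nn = z / 64 by rewrite /z; ring.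
  have -> : nn * (3 / 8 / qq) = 3 / 8 * z by rewrite /z; ring.
  by lra.
pose h := weak w phi st; pose gap x := target s x - value R (phi x).
pose G := (4 * q)%:R^-1 : R.
have G0 : 0 < G by rewrite invr_gt0 ltr0n muln_gt0.
have hb : bounded_ae mu 2 (fun p => gap p.1 * sgnh R h p.1).
  by apply: (bounded_fst (phi := fun x => gap x * sgnh R h x)) => x;
     rewrite normrM sgnh_norm mulr1 gap_le2.
have hb' := bounded_aeN (bounded_aeZ (2 * G) hb).
have hle : loss w (st :: c) <= loss w c - 2 * G * C + G ^+ 2.
  rewrite /C E_corr_fun -/h -(EZ (2 * G) hb) -(EN (bounded_aeZ (2 * G) hb)).
  rewrite -(ED (sqr_gap_bounded _) hb') -[X in _ + X](E_cst mu).
  rewrite -(ED (bounded_aeD (sqr_gap_bounded _) hb') (bounded_ae_cst _)).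
  apply: (le_E (sqr_gap_bounded _)
     (bounded_aeD (bounded_aeD (sqr_gap_bounded _) hb') (bounded_ae_cst _))) => n _ /=.
  have := shift_level_sqr_le q_gt0 phi h (atom mu n).1 (target_bound s_hyp (atom mu n).1).
  by rewrite -/phi.
(* With [G = 1 / (4 q)] the change is at most [- 2 G * 3 / (8 q) + G ^ 2], that is
   [(- 3 + 1) / (16 q ^ 2)]. *)
apply: le_trans hle _.
have GE : G = 4^-1 * q%:R^-1 by rewrite /G natrM invfM.
have -> : ((8 * q * q)%:R)^-1 = 8^-1 * (q%:R^-1 ^+ 2) :> R by rewrite !natrM !invfM expr2; ring.
rewrite GE; move: C_ge; set z := q%:R^-1 : R => C_ge.
have z0 : 0 < z by rewrite invr_gt0.
have : z * (3 / 8 * z) <= z * C by rewrite ler_wpM2l// ltW.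
by nra.
Qed.

Lemma exists_stop w : representative w ->
  exists c, (size c <= rounds q)%N /\ stops S B eta1 eta2 P w c.
Proof.
move=> good; apply: contrapT => /forallNP nostop.
have [c [sc lc]] : exists c, size c = rounds q /\
    loss w c <= 1 - (rounds q)%:R * ((8 * q * q)%:R)^-1.
  suff H t : (t <= rounds q)%N -> exists c, size c = t /\
      loss w c <= 1 - t%:R * ((8 * q * q)%:R)^-1 by exact: H.
  elim: t => [_|t IH tr].
    exists [::]; split=> //; rewrite mul0r subr0 /loss -[leRHS](E_cst mu).
    apply: (le_E (sqr_gap_bounded _) (bounded_ae_cst _)) => n _.
    have -> : value R (lev w [::] (atom mu n).1) = 0.
      rewrite /lev /= /value inordK ?subrr ?mul0r//.
      by rewrite ltnS /top_level leq_mul2r orbT.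
    by rewrite subr0; have := target_bound s_hyp (atom mu n).1; nra.
  have [c [sc lc]] := IH (ltnW tr).
  have [st hst] : exists st,
     N%:R / (2 * q)%:R < \sum_(k < N) corr_fun S B eta1 eta2 P w (lev w c) st (w k).
    apply: contrapT => /forallNP h; apply: (nostop c); split; first by rewrite sc ltnW.
    by move=> st; rewrite leNgt; apply/negP; exact: h.
  exists (st :: c); split; first by rewrite /= sc.
  apply: le_trans (loss_drop good _ hst) _; first by rewrite sc ltnW.
  by rewrite -natr1; move: lc; lra.
(* [rounds] exceeds [8 q ^ 2] by one, so the bound on the loss has become negative. *)
have : 0 <= loss w c by apply: (E_ge0 (sqr_gap_bounded _)) => n _; exact: sqr_ge0.
have p0 : (0 : R) < (8 * q * q)%:R by rewrite ltr0n !muln_gt0 q_gt0.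
have : (rounds q)%:R * ((8 * q * q)%:R)^-1 = 1 + ((8 * q * q)%:R)^-1 :> R.
  by rewrite /rounds -natr1 mulrDl mul1r mulfV ?gt_eqF.
have : (0 : R) < ((8 * q * q)%:R)^-1 by rewrite invr_gt0.
by move: lc; lra.
Qed.

Lemma stop_sound w c tau b : representative w -> (size c <= rounds q)%N ->
  stops S B eta1 eta2 P w c -> B b ->
  E mu (fun p => gprod ((value R (lev w c p.1) - p.2) * level_sign R tau (lev w c) p.1) (b p.1))
    <= q%:R^-1 + 2 * eta1 + 4 * eta2.
Proof.
move=> good sc stop Bb; rewrite leNgt; apply/negP => viol; set phi := lev w c in viol.
(* From [b] only the existence of a violation is kept; the rest concerns the fixed benchmark that
   descriptions refer to. *)
have [Ba va] := adversary_spec (conj Bb viol : violates phi tau b).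
have J0 : (0 < grid_size q)%N by rewrite muln_gt0.
have [j hj] := weak_learning s_hyp s_real
  (fun x => value_bound R q_gt0 (phi x)) (level_sign1 tau phi)
  (@adversary_hyp phi tau) eta1_gt0 eta2_gt0 J0.
pose th := theta R (grid_size q) j; pose a := concept phi tau th.
pose A := agree_class S B (fun x => value R (phi x)) eta1 (level_sign R tau phi) th eta2.
have Ad : vc_le A d by apply: (agree_vc (level_sign1 tau phi) dual_vc).
have Aa : A a by exists s, (adversary phi tau).
have [P_id P_loo] := P_spec Ad.
have [kap hkap] := exists_training_set P_id P_loo (train_size d q) (fun k => (w k).1) N_gt0 Aa.
(* The step whose guessed labels are the true values of the concept is among those that [stops]
   quantifies over. *)
pose st : round := (kap, [ffun l => a (w (kap l)).1], j, [ffun v => tau v]).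
have stE : weak w phi st = P A (restr a [pred z | [exists l, z == (w (kap l)).1]]).
  rewrite /weak /weak_hyp; congr P.
    rewrite /A /level_sign /th /threshold /=; congr agree_class.
    by apply/funext => x; rewrite ffunE.
  apply/funext => x; rewrite /training_data /restr /=.
  case: pickP => [l /eqP lx|nol].
    have -> : [exists l, x == (w (kap l)).1] by apply/existsP; exists l; rewrite -lx.
    by rewrite /guess /= ffunE -lx.
  by case: ifP => // /existsP[l /eqP lx]; have := nol l; rewrite -lx eqxx.
have conceptE : concept phi st.2 (threshold R st) = a.
  rewrite /a /concept /= /th /threshold /=.
  have -> : ([ffun v => tau v] : level -> bool) = tau by apply/funext => v; rewrite ffunE.
  by [].
pose err := E mu (fun p => (mistake a (weak w phi st) p.1)%:R) : R.
(* In units of [1 / q]: [1 / 64] for the mistakes on the sample and [1 / 64] for the tolerance. *)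
have err_le : err <= 1 / 32 / q%:R.
  have testE : test_fun w phi st 2 = fun p => (mistake a (weak w phi st) p.1)%:R.
    by apply/funext => p; rewrite /test_fun conceptE.
  have := @representative_at w c st 2 good sc isT; rewrite -/phi testE -/err.
  have -> : \sum_(k < N) (mistake a (weak w phi st) (w k).1)%:R =
      #|[set i | errs (P A) (fun k => (w k).1) a kap i]%SET|%:R :> R.
    rewrite -sum1_card natr_sum [RHS]big_mkcond/=; apply: eq_bigr => k _.
    by rewrite inE /errs /mistake stE; case: (_ && _).
  set n1 := #|_| => tol.
  have n1_le : n1%:R * (64 * q)%:R <= N%:R :> R.
    have : (n1 * (64 * q) * (2 * d) <= N * (2 * d))%N.
      have := hkap; rewrite -/n1 /train_size; lia.
    have [d0|d0] := posnP d.
      have n10 : n1 = 0%N by have := hkap; rewrite -/n1 d0; lia.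
      by rewrite n10 mul0r.
    by rewrite leq_pmul2r ?muln_gt0// -natrM ler_nat.
  have n1q : 64 * n1%:R <= N%:R / q%:R :> R.
    rewrite ler_pdivlMr//; apply: le_trans n1_le; rewrite natrM.
    by rewrite le_eqVlt; apply/orP; left; apply/eqP; ring.
  rewrite -(ler_pM2l N0); move: tol n1q; rewrite /tolerance natrM invfM.
  have -> : 64^-1 / q%:R * N%:R = N%:R / q%:R / 64 :> R by ring.
  have -> : N%:R * (1 / 32 / q%:R) = N%:R / q%:R / 32 :> R by ring.
  by lra.
have lo : 3 / 4 / q%:R <= E mu (corr_fun S B eta1 eta2 P w phi st).
  have := hj (weak w phi st); rewrite -/th -/a.
  have -> : E mu (fun p => (p.2 - value R (phi p.1)) * sgnh R (weak w phi st) p.1) =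
     E mu (corr_fun S B eta1 eta2 P w phi st) by [].
  rewrite -[E mu (fun p => (_ && _)%:R)]/err.
  move: va err_le; set V := E mu _; set C := E mu _.
  have -> : 4 / (grid_size q)%:R = 1 / 8 / q%:R :> R.
    by rewrite /grid_size natrM; field; rewrite gt_eqF.
  by set z := q%:R^-1; lra.
have tol : N%:R * E mu (corr_fun S B eta1 eta2 P w phi st)
    - \sum_(k < N) corr_fun S B eta1 eta2 P w phi st (w k) <= tolerance * N%:R.
  exact: (@representative_at w c st 0 good sc isT).
have := stop st; rewrite -/(lev w c) -/phi leNgt => /negP; apply.
move: tol; rewrite -/phi; set Sm := \sum_(k < N) _; move: lo; set C := E mu _ => lo tol.
have : N%:R * (3 / 4 / q%:R) <= N%:R * C by rewrite ler_pM2l.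
move: tol; rewrite /tolerance !natrM !invfM.
have -> : 64^-1 / q%:R * N%:R = N%:R / q%:R / 64 :> R by ring.
have -> : N%:R * (3 / 4 / q%:R) = N%:R / q%:R * (3 / 4) :> R by ring.
have -> : N%:R * (2^-1 / q%:R) = N%:R / q%:R / 2 :> R by ring.
have : (0 : R) < N%:R / q%:R by rewrite divr_gt0.
by lra.
Qed.

Lemma MCerr_boost w : representative w ->
  (MCerr mu B (boost S B eta1 eta2 d q P w) <= (q%:R^-1 + 2 * eta1 + 4 * eta2)%:E)%E.
Proof.
move=> good; have [sc stop] := xgetPex [::] (exists_stop good).
rewrite /boost; set c := xget _ _ in sc stop *.
apply: MCerr_le => //; first exact: label_bounded s_real.
  by move=> x; exact: predictor_bound.
move=> b zeta Bb sz.
pose tau (l : level) := zeta (value R l) == 1.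
have zE l : zeta (value R l) = sgnb R (tau l).
  by rewrite /tau /sgnb; case: eqP => // h; case: (sz (value R l)).
rewrite /signed_corr.
apply: le_trans (stop_sound tau good sc stop Bb).
rewrite le_eqVlt; apply/orP; left; apply/eqP; apply: eq_E => n _.
by rewrite /predictor zE.
Qed.

End Analysis.

(** * Sample size *)

(** The agreement class changes with every step, so a predictor is fixed in advance for all classes
    at once. *)
Lemma predictor_family (X : choiceType) (d : nat) :
  exists P : set (X -> option bool) -> (X -> option bool) -> X -> bool,
  forall A, vc_le A d ->
  (forall g x l, g x = Some l -> P A g x = l) /\
  forall a ys, A a -> uniq ys -> (forall x, x \in ys -> a x <> None) ->
    (count (fun x => Some (P A (restr a [pred z | (z \in ys) && (z != x)]) x) != a x) ys
       <= 2 * d)%N.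
Proof.
have : forall A : set (X -> option bool), exists PA, vc_le A d ->
  (forall g x l, g x = Some l -> PA g x = l) /\
  forall a ys, A a -> uniq ys -> (forall x, x \in ys -> a x <> None) ->
    (count (fun x => Some (PA (restr a [pred z | (z \in ys) && (z != x)]) x) != a x) ys
       <= 2 * d)%N.
  move=> A; have [Ad|nAd] := pselect (vc_le A d); last by exists (fun _ _ => true).
  by have [PA hPA] := leave_one_out Ad; exists PA.
by move=> /choice[P hP]; exists P.
Qed.

Section SampleSize.
Variable R : realType.

(** This is [64 * 64 * 512], so that the deviation exponent per point, [tolerance ^ 2 / 512], equals
    [1 / (unit_cost * q ^ 2)]. *)
Definition unit_cost : R := 2 ^+ 21.
Definition log_scale : R := 6 * 1280 * unit_cost.

(** At most [10 q ^ 2] steps with [128 d q] indices each give the factor [1280 d q ^ 3]; the term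
    [440 q ^ 3] covers sign patterns, thresholds and lengths. The parameter [lam] stands in for the
    logarithm of the sample size, which may not occur in its own bound. *)
Definition sample_cost (q d : nat) (delta lam : R) : R :=
  2 * unit_cost * q%:R ^+ 2 *
    (ln delta^-1 + 440 * q%:R ^+ 3 + 1280 * (d%:R * q%:R ^+ 3 * lam)).

Lemma unit_cost_ge1 : 1 <= unit_cost.
Proof. by apply: exprn_ege1; lra. Qed.

Lemma log_scale_ge1 : 1 <= log_scale.
Proof. by have := unit_cost_ge1; rewrite /log_scale; lra. Qed.

Variables (q d N : nat) (delta lam : R).
Hypotheses (q_gt0 : (0 < q)%N) (delta_gt0 : 0 < delta) (delta_lt1 : delta < 1).
Hypothesis lam_ge1 : 1 <= lam.
Hypothesis lam_ge : (0 < d)%N -> ln (log_scale * (d%:R * q%:R ^+ 5)) <= lam.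
Hypothesis N_ge : sample_cost q d delta lam <= N%:R.

Let K := unit_cost.
Let K_gt0 : 0 < K. Proof. exact: lt_le_trans unit_cost_ge1. Qed.
Let Q : R := q%:R.
Let Q_ge1 : 1 <= Q. Proof. by rewrite ler1n. Qed.
Let Q_gt0 : 0 < Q. Proof. exact: lt_le_trans Q_ge1. Qed.
Let Q3_ge1 : 1 <= Q ^+ 3. Proof. exact: exprn_ege1. Qed.
Let lnd_ge0 : 0 <= ln delta^-1. Proof. by rewrite ln_ge0// invf_ge1 ?ltW. Qed.
Let dQ3_ge0 : 0 <= d%:R * Q ^+ 3. Proof. by rewrite mulr_ge0// exprn_ge0 ?ltW. Qed.

Let t : R := N%:R / (2 * K * Q ^+ 2).

Let cost_le : ln delta^-1 + 440 * Q ^+ 3 + 1280 * (d%:R * Q ^+ 3 * lam) <= t.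
Proof.
have KQ : 0 < 2 * K * Q ^+ 2 by apply: mulr_gt0; [apply: mulr_gt0|apply: exprn_gt0].
by rewrite /t ler_pdivlMr// mulrC.
Qed.

Let dQ3_le : d%:R * Q ^+ 3 <= d%:R * Q ^+ 3 * lam.
Proof. by rewrite -[leLHS]mulr1 ler_wpM2l. Qed.

Let t_gt0 : 0 < t.
Proof. have h1 := cost_le; have h2 := dQ3_le; have h3 := dQ3_ge0; have h4 := Q3_ge1;
by have := lnd_ge0; lra. Qed.

Lemma sample_gt0 : (0 < N)%N.
Proof.
by rewrite lt0n; apply/eqP => N0; have := t_gt0; rewrite /t N0 mul0r ltxx.
Qed.

Let t_tolerance : N%:R * tolerance R q ^+ 2 / 512 = 2 * t.
Proof.
rewrite /t /tolerance natrM -/Q.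
have -> : K = 64 * 64 * 512 by rewrite /K /unit_cost; ring.
by field; rewrite gt_eqF.
Qed.

Let rounds_le : (rounds q).+1%:R <= 10 * Q ^+ 2.
Proof.
have e : (rounds q).+1%:R = 8 * Q * Q + 1 + 1 :> R by rewrite /rounds -natr1 -natr1 !natrM.
have Q2 : 1 <= Q ^+ 2 by exact: exprn_ege1.
by rewrite e -mulrA -expr2; lra.
Qed.

Let train_sizeE : (train_size d q)%:R = 128 * (d%:R * Q) :> R.
Proof. by rewrite /train_size !natrM mulrA. Qed.

Lemma few_indices : 8 * ((rounds q).+1 * train_size d q)%:R <= tolerance R q * N%:R.
Proof.
have NE : tolerance R q * N%:R = K / 32 * Q * t.
  by rewrite /t /tolerance natrM -/Q; field; rewrite ?gt_eqF.
have dQ : 0 <= d%:R * Q by rewrite mulr_ge0// ltW.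
have h1 : (rounds q).+1%:R * (d%:R * Q) <= 10 * Q ^+ 2 * (d%:R * Q) by rewrite ler_wpM2r.
have h2 : 10 * Q ^+ 2 * (d%:R * Q) = 10 * (d%:R * Q ^+ 3) by ring.
have h3 : 8 * ((rounds q).+1 * train_size d q)%:R <= 8 * t.
  have -> : 8 * ((rounds q).+1 * train_size d q)%:R =
      1024 * ((rounds q).+1%:R * (d%:R * Q)) :> R by rewrite natrM train_sizeE; ring.
  have := cost_le; have := dQ3_le; have := dQ3_ge0; have := Q3_ge1; have := lnd_ge0.
  by move: h1; rewrite h2; lra.
apply: le_trans h3 _; rewrite NE; apply: ler_wpM2r; first exact: ltW.
have K8 : 8 <= K / 32.
  have -> : K = 256 * (2 ^+ 13) by rewrite /K /unit_cost; ring.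
  have : (1 : R) <= 2 ^+ 13 by apply: exprn_ege1; lra.
  by lra.
apply: le_trans K8 _; rewrite -[leLHS]mulr1 ler_wpM2l//.
by rewrite divr_ge0// ltW.
Qed.

Lemma leR_expR (x : R) : x <= expR x.
Proof. by apply: le_trans (expR_ge1Dx x); rewrite lerDr. Qed.

(** Removes the circularity between [N] and its logarithm by [ln x <= ln A + x / A]; [log_scale] is
    chosen to make the remainder exactly [t]. *)
Let ln_sample_le : (0 < d)%N ->
  1280 * (d%:R * Q ^+ 3 * ln (3 * N%:R)) <= 1280 * (d%:R * Q ^+ 3 * lam) + t.
Proof.
move=> d0; pose A := log_scale * (d%:R * Q ^+ 5).
have dR : 0 < d%:R :> R by rewrite ltr0n.
have A0 : 0 < A.
  apply: mulr_gt0; first exact: lt_le_trans log_scale_ge1.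
  by apply: mulr_gt0 => //; apply: exprn_gt0.
have N0 : 0 < N%:R :> R by rewrite ltr0n sample_gt0.
have NA0 : 0 < 3 * N%:R / A by rewrite divr_gt0// mulr_gt0.
have h : ln (3 * N%:R) <= lam + 3 * N%:R / A.
  have e : 3 * N%:R = A * (3 * N%:R / A) by rewrite mulrCA mulfV ?mulr1 ?gt_eqF.
  rewrite {1}e lnM ?posrE// lerD//; first exact: lam_ge.
  have := @le_ln1Dx R (3 * N%:R / A - 1); rewrite [1 + _]addrC subrK => h.
  by apply: le_trans (h _) _; lra.
have tE : 1280 * (d%:R * Q ^+ 3 * (3 * N%:R / A)) = t.
  rewrite /t /A /log_scale -/K; field; by rewrite !gt_eqF.
have := ler_wpM2l dQ3_ge0 h; rewrite mulrDr => h'.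
by rewrite -tE; lra.
Qed.

(** The deviation exponent is [2 t]: one [t] pays for the bracket in [sample_cost], the other for
    the remainder in [ln_sample_le]. *)
Lemma description_count :
  #|{: description d q N}|%:R * expR (- (N%:R * tolerance R q ^+ 2 / 512)) <= delta.
Proof.
have N0 : 0 < N%:R :> R by rewrite ltr0n sample_gt0.
pose L := ln (3 * N%:R) : R.
have L0 : 0 <= L by have N1 : (1 : R) <= N%:R; [rewrite ler1n sample_gt0|rewrite ln_ge0//; lra].
pose r : R := (rounds q).+1%:R; pose n0 := train_size d q.
have stepE : #|{: step d q N}|%:R <= expR (n0%:R * L + 40 * Q + 1).
  have -> : #|{: step d q N}| = ((N * 3) ^ n0 * grid_size q * 2 ^ (top_level q).+1)%N.
    by rewrite !card_prod !card_ffun !card_ord card_option card_bool expnMn.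
  have -> : n0%:R * L + 40 * Q + 1 = n0%:R * L + 32 * Q + (8 * Q + 1) by ring.
  rewrite natrM natrM expRD; apply: ler_pM; rewrite ?mulr_ge0 ?ler0n//.
    rewrite expRD; apply: ler_pM; rewrite ?ler0n//.
      rewrite natrX natrM expRM_natl /L lnK ?posrE ?mulr_gt0// mulrC//.
    by rewrite /grid_size natrM; exact: leR_expR.
  have -> : 8 * Q + 1 = (top_level q).+1%:R * 1 by rewrite mulr1 -[_.+1%:R in RHS]natr1 /top_level natrM.
  rewrite natrX expRM_natl lerXn2r ?nnegrE ?expR_ge0//.
  by apply: le_trans (expR_ge1Dx 1); lra.
have r_le : r <= 10 * Q ^+ 2 by exact: rounds_le.
have r0 : 0 <= r by rewrite ler0n.
pose Z := r + r * (n0%:R * L + 40 * Q + 1) + 3.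
have cardE : #|{: description d q N}|%:R <= expR Z.
  have -> : #|{: description d q N}| =
      ((rounds q).+1 * #|{: step d q N}| ^ (rounds q).+1 * 3)%N.
    by rewrite [LHS]card_prod [in LHS]card_prod card_tuple !card_ord.
  rewrite natrM [((rounds q).+1 * _)%:R]natrM natrX /Z expRD.
  have p0 : 0 <= #|{: step d q N}|%:R ^+ (rounds q).+1 :> R by apply: exprn_ge0; exact: ler0n.
  apply: ler_pM; [exact: mulr_ge0 (ler0n _ _) p0|exact: ler0n| |exact: leR_expR].
  rewrite expRD; apply: ler_pM; [exact: ler0n|exact: p0|exact: leR_expR|].
  by rewrite expRM_natl lerXn2r ?nnegrE ?expR_ge0.
have Z_le : Z <= 440 * Q ^+ 3 + 1280 * (d%:R * Q ^+ 3 * L).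
  have n0L : 0 <= n0%:R * L by rewrite mulr_ge0.
  have e0 : 0 <= n0%:R * L + 40 * Q + 1 by have := Q_gt0; lra.
  have h1 : r * (n0%:R * L + 40 * Q + 1) <= 10 * Q ^+ 2 * (n0%:R * L + 40 * Q + 1).
    by rewrite ler_wpM2r.
  have e1 : 10 * Q ^+ 2 * (n0%:R * L + 40 * Q + 1) =
     1280 * (d%:R * Q ^+ 3 * L) + 400 * Q ^+ 3 + 10 * Q ^+ 2.
    by rewrite /n0 train_sizeE; ring.
  have Q23 : Q ^+ 2 <= Q ^+ 3 by rewrite ler_weXn2l.
  by rewrite /Z; have := Q3_ge1; move: h1 r_le; rewrite e1; lra.
have final : Z - 2 * t <= ln delta.
  have := cost_le; rewrite lnV ?posrE// => c.
  have [d0|d0] := posnP d.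
    by have := t_gt0; move: Z_le c; rewrite d0 !mul0r !mulr0 !addr0; lra.
  by have := ln_sample_le d0; rewrite -/L; move: Z_le c; lra.
rewrite t_tolerance.
apply: le_trans (_ : expR Z * expR (- (2 * t)) <= _).
  by rewrite ler_wpM2r ?expR_ge0.
by rewrite -expRD -[leRHS](lnK (x := delta)) ?posrE// ler_expR.
Qed.

End SampleSize.

Section UpperBound.
Variables (R : realType) (X : choiceType) (S B : set (X -> option R)) (eta1 eta2 : R).
Variables (d q N : nat) (delta lam eps : R).
Hypotheses (S_hyp : hyp_class S) (B_hyp : hyp_class B).
Hypotheses (eta1_gt0 : 0 < eta1) (eta2_gt0 : 0 < eta2).
Hypothesis dual_vc : dual_vc_le S B eta1 eta2 d.
Hypotheses (q_gt0 : (0 < q)%N) (delta_gt0 : 0 < delta) (delta_lt1 : delta < 1).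
Hypothesis lam_ge1 : 1 <= lam.
Hypothesis lam_ge : (0 < d)%N -> ln (log_scale R * (d%:R * q%:R ^+ 5)) <= lam.
Hypothesis N_ge : sample_cost q d delta lam <= N%:R.
Hypothesis eps_ge : q%:R^-1 + 2 * eta1 + 4 * eta2 <= eps.

Lemma numMC_le_sample : (numMC S B eps delta <= N%:R%:E)%E.
Proof.
have [P P_spec] := predictor_family X d.
have N0 := sample_gt0 q_gt0 delta_gt0 delta_lt1 lam_ge1 N_ge.
apply: ereal_inf_lbound; exists N => //; exists (boost S B eta1 eta2 d q P); split.
  by move=> w x; exact: predictor_bound.
split=> [w|mu [s [Ss s_real]]].
  by apply: finite_set_countable; exact: boost_finite_range.
have tol0 : 0 < tolerance R q by rewrite invr_gt0 ltr0n muln_gt0.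
have tol1 : tolerance R q <= 1 by rewrite invf_le1 ?ltr0n ?muln_gt0// ler1n muln_gt0.
apply: (@Pn_ge _ _ mu N (description d q N) (described S B eta1 eta2 P mu s)
   (@description_indices d q N) (tolerance R q)) => //.
- by move=> e w; exact: described_bounded.
- by move=> e w w'; exact: described_ext.
- move=> e; apply: le_trans (few_indices q_gt0 delta_gt0 delta_lt1 lam_ge1 N_ge).
  by rewrite ler_wpM2l// ler_nat description_indices_card.
- exact: description_count lam_ge N_ge.
- move=> w _ rep; apply: le_trans (_ : ((q%:R^-1 + 2 * eta1 + 4 * eta2)%:E <= _)%E).
    exact: (MCerr_boost S_hyp B_hyp eta1_gt0 eta2_gt0 dual_vc q_gt0 N0 P_spec Ss s_real rep).
  by rewrite lee_fin.
Qed.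

End UpperBound.

(** * The theorem *)

Section Bounds.
Variable R : realType.
Implicit Types (m beta eta eps delta u : R).

Lemma ln2_ge : 1 / 2 <= ln (2 : R).
Proof.
rewrite -[leLHS]expRK ler_ln ?posrE ?expR_gt0//.
have h : (1 / 2 : R) <= expR (- (1 / 2)).
  by apply: le_trans (expR_ge1Dx _); lra.
have := expR_gt0 (1 / 2 : R); have e : expR (1 / 2) * expR (- (1 / 2)) = 1 :> R.
  by rewrite -expRD subrr expR0.
by nra.
Qed.

Lemma ln2_le : ln (2 : R) <= 1.
Proof. by have := @le_ln1Dx R 1; apply; lra. Qed.

Lemma logp_ge1 u : 1 <= logp u.
Proof.
have := ln2_ge => l2; rewrite /logp ler_pdivlMr ?mul1r; last by lra.
by rewrite ler_ln ?posrE ?lt_max ?ltr0n// le_max lexx.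
Qed.

Lemma ln_le_logp u : 0 < u -> ln u <= ln 2 * logp u.
Proof.
move=> u0; have := ln2_ge => l2; rewrite /logp mulrC divfK; last by rewrite gt_eqF//; lra.
by rewrite ler_ln ?posrE ?lt_max ?u0 ?orbT// le_max lexx orbT.
Qed.

Lemma ln_inv_ge eta : in_half eta -> 1 / 2 <= ln (1 / eta).
Proof.
move=> [e0 e1]; apply: le_trans ln2_ge _; rewrite ler_ln ?posrE ?divr_gt0//.
by rewrite ler_pdivlMr//; lra.
Qed.

Lemma ln4 : ln (4 : R) = 2 * ln 2.
Proof.
have -> : 4 = 2 * 2 :> R by ring.
by rewrite lnM ?posrE//; ring.
Qed.

Lemma ln7_le : ln (7 : R) <= 3 * ln 2.
Proof.
have -> : 3 * ln 2 = ln 8 :> R.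
  have -> : 8 = 2 * (2 * 2) :> R by ring.
  by rewrite !lnM ?posrE ?mulr_gt0//; ring.
by rewrite ler_ln ?posrE//; lra.
Qed.

Lemma ln_inv2_ge beta delta : in_half beta -> in_half delta ->
  2 * ln 2 <= ln (1 / (beta * delta)).
Proof.
move=> [b0 b1] [d0 d1]; have bd : 0 < beta * delta by rewrite mulr_gt0.
by rewrite -ln4 ler_ln ?posrE ?divr_gt0// ler_pdivlMr//; nra.
Qed.

(** Common core of both stated bounds: their factors [ln (1 / eta1)] and [ln (1 / eps)] are at least
    [1 / 2], so passing from this to either costs a constant. *)
Definition main_bound m beta delta : R :=
  m / beta ^+ 6 * logp (m / beta) ^+ 2 + 1 / beta ^+ 6 * ln (1 / (beta * delta)).

Definition main_const : R :=
  2 * unit_cost R * (4000 + 1280 * (8 * (ln (log_scale R) + 10))) + 1.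

Lemma lnc_ge0 : 0 <= ln (log_scale R).
Proof. by rewrite ln_ge0// log_scale_ge1. Qed.

Lemma main_const_gt0 : 0 < main_const.
Proof. by rewrite /main_const; have := unit_cost_ge1 R; have := lnc_ge0; nra. Qed.

Lemma main_bound_ge0 m beta delta : 0 <= m -> in_half beta -> in_half delta ->
  0 <= main_bound m beta delta.
Proof.
move=> m0 hb hd; have := ln_inv2_ge hb hd; have := ln2_ge; case: hb => b0 _ h1 h2.
have b6 : 0 <= beta ^+ 6 by apply: exprn_ge0; exact: ltW.
apply: addr_ge0; apply: mulr_ge0; [exact: divr_ge0|exact: sqr_ge0|exact: divr_ge0|lra].
Qed.

Lemma ln_dq5_le (q d : nat) (m z : R) : (0 < d)%N -> (0 < q)%N -> d%:R <= m ->
  0 < z -> q%:R <= 3 / 2 * z ->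
  ln (log_scale R * (d%:R * q%:R ^+ 5)) <= (ln (log_scale R) + 10) * logp (m * z).
Proof.
move=> d0 q0 dm z0 qz; set L := logp _.
have dR : 1 <= d%:R :> R by rewrite ler1n.
have q1 : 1 <= q%:R :> R by rewrite ler1n.
have dq0 : 0 < d%:R * q%:R :> R by apply: mulr_gt0; lra.
have mz0 : 0 < m * z by apply: mulr_gt0 => //; lra.
have L1 : 1 <= L by exact: logp_ge1.
have h1 : d%:R * q%:R ^+ 5 <= (d%:R * q%:R) ^+ 5 :> R.
  rewrite exprMn ler_wpM2r ?exprn_ge0//; rewrite exprS -[leLHS]mulr1 ler_wpM2l//.
  exact: exprn_ege1.
have h2 : d%:R * q%:R <= 2 * (m * z) :> R.
  have : d%:R * q%:R <= m * (3 / 2 * z) by apply: ler_pM.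
  by nra.
have h3 : ln (d%:R * q%:R) <= 2 * L :> R.
  have : ln (d%:R * q%:R) <= ln (2 * (m * z)) :> R by rewrite ler_ln ?posrE// mulr_gt0.
  rewrite [ln (2 * _)]lnM ?posrE//; have := ln_le_logp mz0; rewrite -/L.
  by have := ln2_le; have := ln2_ge; nra.
have k0 : 0 < log_scale R by exact: lt_le_trans (log_scale_ge1 R).
have p5 : 0 < d%:R * q%:R ^+ 5 :> R by apply: mulr_gt0; [lra|apply: exprn_gt0; lra].
rewrite lnM ?posrE//.
have h4 : ln (d%:R * q%:R ^+ 5) <= 10 * L :> R.
  apply: le_trans (_ : ln ((d%:R * q%:R) ^+ 5) <= _); first by rewrite ler_ln ?posrE ?exprn_gt0.
  by rewrite lnXn// -[_ *+ _]mulr_natl; lra.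
have : 0 <= ln (log_scale R) * (L - 1) by rewrite mulr_ge0 ?lnc_ge0// subr_ge0.
by rewrite mulrBr mulr1 mulrDl; lra.
Qed.

Lemma sample_cost_le (q d : nat) (m z delta D c1 L : R) :
  0 < delta < 1 -> d%:R <= m -> 2 < z -> q%:R <= 3 / 2 * z -> ln delta^-1 <= D ->
  0 <= c1 -> 1 <= L ->
  0 <= sample_cost q d delta (c1 * L) <=
  2 * unit_cost R * (3 * (z ^+ 6 * D) + 3520 * z ^+ 6 + 1280 * (8 * c1) * (m * z ^+ 6 * L ^+ 2)).
Proof.
move=> /andP[dl0 dl1] dm z2 qz lnD c0 L1.
have d0 : 0 <= d%:R :> R by exact: ler0n.
have lnd0 : 0 <= ln delta^-1 by rewrite ln_ge0// invf_ge1// ltW.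
have q0 : 0 <= q%:R :> R by exact: ler0n.
have q30 : 0 <= q%:R ^+ 3 :> R by exact: exprn_ge0.
have q50 : 0 <= q%:R ^+ 5 :> R by exact: exprn_ge0.
have dq30 : 0 <= d%:R * q%:R ^+ 3 * (c1 * L).
  by apply: mulr_ge0; [exact: mulr_ge0|apply: mulr_ge0 => //; lra].
have K0 : 0 <= 2 * unit_cost R by have := unit_cost_ge1 R; lra.
apply/andP; split; rewrite /sample_cost.
  by apply: mulr_ge0; [apply: mulr_ge0 => //; exact: sqr_ge0|lra].
rewrite -[_ * q%:R ^+ 2 * _]mulrA; apply: ler_wpM2l => //.
have q2 : q%:R ^+ 2 <= 3 * z ^+ 2 :> R by rewrite !expr2; nra.
have z50 : 0 <= z ^+ 5 by apply: exprn_ge0; lra.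
have q5 : q%:R ^+ 5 <= 8 * z ^+ 5.
  have : q%:R ^+ 5 <= (3 / 2 * z) ^+ 5 by rewrite lerXn2r ?nnegrE//; lra.
  by rewrite exprMn (_ : (3 / 2) ^+ 5 = 243 / 32 :> R); [lra|field].
have z1 : 1 <= z by lra.
have z56 : z ^+ 5 <= z ^+ 6 by rewrite ler_weXn2l.
have z26 : z ^+ 2 <= z ^+ 6 by rewrite ler_weXn2l.
have t1 : q%:R ^+ 2 * ln delta^-1 <= 3 * z ^+ 6 * D.
  by apply: ler_pM => //; lra.
have t2 : q%:R ^+ 5 <= 8 * z ^+ 6 by lra.
have t3 : d%:R * q%:R ^+ 5 * (c1 * L) <= m * (8 * z ^+ 6) * (c1 * L ^+ 2).
  have a1 : d%:R * q%:R ^+ 5 <= m * (8 * z ^+ 6) by exact: ler_pM.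
  have a2 : c1 * L <= c1 * L ^+ 2 by apply: ler_wpM2l => //; rewrite expr2; nra.
  by apply: ler_pM => //; apply: mulr_ge0 => //; lra.
have -> : q%:R ^+ 2 * (ln delta^-1 + 440 * q%:R ^+ 3 + 1280 * (d%:R * q%:R ^+ 3 * (c1 * L))) =
   q%:R ^+ 2 * ln delta^-1 + 440 * q%:R ^+ 5 + 1280 * (d%:R * q%:R ^+ 5 * (c1 * L)) by ring.
have -> : 1280 * (8 * c1) * (m * z ^+ 6 * L ^+ 2) = 1280 * (m * (8 * z ^+ 6) * (c1 * L ^+ 2)) by ring.
by lra.
Qed.

Lemma absorb_constants (K c1 G1 z6 D Y : R) : 1 <= K -> 0 <= c1 -> 0 <= G1 -> 1 <= z6 -> 1 <= D ->
  Y <= 2 * K * (3 * (z6 * D) + 3520 * z6 + 1280 * (8 * c1) * G1) ->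
  Y + 1 <= (2 * K * (4000 + 1280 * (8 * c1)) + 1) * (G1 + z6 * D).
Proof.
move=> K1 c0 G0 z1 D1 hY.
have zD : z6 <= z6 * D by rewrite -[leLHS]mulr1 ler_wpM2l//; lra.
set G2 := z6 * D in zD hY *.
have cG : 0 <= c1 * G2 by apply: mulr_ge0; lra.
have h : 3 * G2 + 3520 * z6 + 1280 * (8 * c1) * G1 <= (4000 + 1280 * (8 * c1)) * (G1 + G2).
  have -> : (4000 + 1280 * (8 * c1)) * (G1 + G2) = 4000 * G1 + 4000 * G2
    + 1280 * (8 * c1) * G1 + 1280 * (8 * (c1 * G2)) by ring.
  by lra.
have K0 : 0 <= 2 * K by lra.
have := ler_wpM2l K0 h; rewrite [X in Y + 1 <= X]mulrDl mul1r -[_ * _ * (G1 + G2)]mulrA.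
by lra.
Qed.

Lemma numMC_main (X : choiceType) (S B : set (X -> option R)) m (d : nat) beta eta1 eta2 delta :
  hyp_class S -> hyp_class B -> in_half beta -> in_half eta1 -> in_half eta2 -> in_half delta ->
  d%:R <= m -> dual_vc_le S B eta1 eta2 d ->
  (numMC S B (beta + 2 * eta1 + 4 * eta2) delta <= (main_const * main_bound m beta delta)%:E)%E.
Proof.
move=> hS hB hb [e10 _] [e20 _] hd dm dvc; have [b0 b1] := hb; have [d0 d1] := hd.
pose z := beta^-1; have z0 : 0 < z by rewrite invr_gt0.
have zb : z * beta = 1 by rewrite mulVf ?gt_eqF.
have z2 : 2 < z by rewrite -(ltr_pM2r b0) zb; lra.
(* Rounding up makes [1 / q] at most [beta], and [z > 2] gives [q <= z + 1 <= 3 / 2 * z]. *)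
pose q := (Num.truncn z).+1.
have [qz1 qz2] : z < q%:R /\ q%:R <= z + 1.
  have /andP[h1 h2] := truncn_itv (ltW z0); split=> //.
  by rewrite /q -natr1 lerD2r.
have qz : q%:R <= 3 / 2 * z by lra.
have q0 : 0 < q%:R :> R by lra.
pose L := logp (m / beta); have L1 : 1 <= L by exact: logp_ge1.
pose c1 := ln (log_scale R) + 10; have c1_ge : 10 <= c1 by rewrite lerDr lnc_ge0.
have c10 : 0 <= c1 by exact: le_trans c1_ge.
have lam1 : 1 <= c1 * L by nra.
have z6 : 1 <= z ^+ 6 by apply: exprn_ege1; lra.
have D1 : 1 <= ln (1 / (beta * delta)) by have := ln_inv2_ge hb hd; have := ln2_ge; lra.
have dlt1 : delta < 1 by lra.
have lam_ge : (0 < d)%N -> ln (log_scale R * (d%:R * q%:R ^+ 5)) <= c1 * L.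
  by move=> dpos; apply: ln_dq5_le.
have bd0 : 0 < beta * delta by apply: mulr_gt0.
have D_ge : ln delta^-1 <= ln (1 / (beta * delta)).
  rewrite ler_ln ?posrE ?invr_gt0 ?divr_gt0// div1r invfM -[leLHS]mul1r.
  by rewrite ler_wpM2r ?invr_ge0 ?ltW//; rewrite -/z; lra.
have /andP[Y0 Y_le] : 0 <= sample_cost q d delta (c1 * L) <= 2 * unit_cost R *
    (3 * (z ^+ 6 * ln (1 / (beta * delta))) + 3520 * z ^+ 6
       + 1280 * (8 * c1) * (m * z ^+ 6 * L ^+ 2)).
  by apply: sample_cost_le => //; apply/andP; split; lra.
set Y := sample_cost _ _ _ _ in Y0 Y_le; pose N := (Num.truncn Y).+1.
have N_ge : Y <= N%:R by rewrite ltW// truncnS_gt.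
have N_le : N%:R <= Y + 1.
  by have /andP[h1 _] := truncn_itv Y0; rewrite /N -natr1 lerD2r.
have eps_ge : q%:R^-1 + 2 * eta1 + 4 * eta2 <= beta + 2 * eta1 + 4 * eta2.
  by rewrite !lerD2r -[leRHS]invrK lef_pV2 ?posrE// ltW.
apply: le_trans (numMC_le_sample hS hB e10 e20 dvc (isT : (0 < q)%N) d0 dlt1 lam1 lam_ge N_ge eps_ge) _.
rewrite lee_fin; apply: le_trans N_le _.
have -> : main_bound m beta delta = m * z ^+ 6 * L ^+ 2 + z ^+ 6 * ln (1 / (beta * delta)).
  by rewrite /main_bound -/L /z exprVn mul1r.
have G10 : 0 <= m * z ^+ 6 * L ^+ 2.
  apply: mulr_ge0; last exact: sqr_ge0.
  by apply: mulr_ge0; [exact: le_trans dm|exact: le_trans z6].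
exact: (absorb_constants (unit_cost_ge1 R) c10 G10 z6 D1 Y_le).
Qed.

Lemma main_bound_le_bound1 m beta eta1 eta2 delta :
  0 <= m -> in_half beta -> in_half eta1 -> in_half eta2 -> in_half delta ->
  main_bound m beta delta <= 2 * bound1 m beta eta1 eta2 delta.
Proof.
move=> m0 hb h1 h2 hd; have l1 := ln_inv_ge h1; have l2 := ln_inv_ge h2.
have := main_bound_ge0 m0 hb hd; have [b0 _] := hb.
have t3 : 0 <= 1 / beta ^+ 4 * ln (1 / eta2).
  by rewrite mulr_ge0 ?divr_ge0 ?exprn_ge0 ?ltW//; lra.
rewrite /bound1 => g0; set l := ln (1 / eta1) in l1 *.
have -> : m / beta ^+ 6 * logp (m / beta) ^+ 2 * l + 1 / beta ^+ 6 * l * ln (1 / (beta * delta)) =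
  main_bound m beta delta * l by rewrite /main_bound; ring.
by nra.
Qed.

Lemma in_half_div7 eps : in_half eps -> in_half (eps / 7).
Proof. by case=> e0 e1; split; lra. Qed.

Lemma main_bound_le_bound2 m eps delta : 0 <= m -> in_half eps -> in_half delta ->
  main_bound m (eps / 7) delta <= 2 * (16 * 7 ^+ 6) * bound2 m eps delta.
Proof.
move=> m0 he hd; have [e0 e1] := he; have [d0 d1] := hd.
have l1 := ln_inv_ge he; have l2 := ln2_ge; have l7 := ln7_le.
have D2 := ln_inv2_ge he hd; set D := ln (1 / (eps * delta)) in D2.
have ed : 0 < eps * delta by rewrite mulr_gt0.
have lnE : ln (1 / (eps / 7 * delta)) = ln 7 + D.
  have -> : 1 / (eps / 7 * delta) = 7 * (1 / (eps * delta)) by field; rewrite !gt_eqF.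
  by rewrite lnM ?posrE ?divr_gt0.
have uE : m / (eps / 7) = 7 * (m / eps) by field; rewrite gt_eqF.
set u := m / eps in uE; have u0 : 0 <= u by rewrite divr_ge0// ltW.
have Lu := logp_ge1 u.
(* Since 7 is below 8, scaling by 7 adds at most 3 to the binary logarithm, and [logp u >= 1]. *)
have L7 : logp (7 * u) <= 4 * logp u.
  rewrite {1}/logp ler_pdivrMr; last by lra.
  have [h|h] := leP 2 (7 * u).
    have u1 : 0 < u by lra.
    by rewrite lnM ?posrE//; have := ln_le_logp u1; nra.
  by nra.
have L0 : 0 <= logp (7 * u) by have := logp_ge1 (7 * u); lra.
have L72 : logp (7 * u) ^+ 2 <= 16 * logp u ^+ 2.
  have : logp (7 * u) ^+ 2 <= (4 * logp u) ^+ 2 by rewrite lerXn2r ?nnegrE//; lra.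
  by rewrite [(4 * _) ^+ 2]exprMn (_ : 4 ^+ 2 = 16 :> R)//; ring.
pose y6 := (eps ^+ 6)^-1; have y0 : 0 <= y6 by rewrite invr_ge0 exprn_ge0// ltW.
have b6 : ((eps / 7) ^+ 6)^-1 = 7 ^+ 6 * y6.
  by rewrite /y6 exprMn exprVn invfM invrK mulrC.
have s6 : (0 : R) <= 7 ^+ 6 by rewrite exprn_ge0.
have G'E : main_bound m eps delta = m * y6 * logp u ^+ 2 + y6 * D.
  by rewrite /main_bound mul1r.
have step1 : main_bound m (eps / 7) delta <= 16 * 7 ^+ 6 * main_bound m eps delta.
  rewrite G'E /main_bound uE lnE b6 mul1r.
  have h1 : m * (7 ^+ 6 * y6) * logp (7 * u) ^+ 2 <= m * (7 ^+ 6 * y6) * (16 * logp u ^+ 2).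
    by rewrite ler_wpM2l// !mulr_ge0.
  have h2 : 7 ^+ 6 * y6 * (ln 7 + D) <= 7 ^+ 6 * y6 * (16 * D).
    by rewrite ler_wpM2l ?mulr_ge0//; lra.
  apply: le_trans (lerD h1 h2) _.
  by rewrite le_eqVlt; apply/orP; left; apply/eqP; ring.
have G0 := main_bound_ge0 m0 he hd.
have b2E : bound2 m eps delta = main_bound m eps delta * ln (1 / eps).
  by rewrite /bound2 /main_bound; ring.
have h : main_bound m eps delta <= 2 * bound2 m eps delta by rewrite b2E; nra.
have k0 : (0 : R) <= 16 * 7 ^+ 6 by exact: mulr_ge0.
have e : 2 * (16 * 7 ^+ 6) * bound2 m eps delta = 16 * 7 ^+ 6 * (2 * bound2 m eps delta) by ring.
by apply: le_trans step1 _; rewrite e; exact: ler_wpM2l.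
Qed.

End Bounds.

Theorem theorem5p3 (R : realType) :
  exists C : R, 0 < C /\
  forall (X : Type) (x0 : X) (S B : set (X -> option R)),
    hyp_class S -> hyp_class B ->
    (forall beta eta1 eta2 delta : R,
       in_half beta -> in_half eta1 -> in_half eta2 -> in_half delta ->
       (numMA S B (beta + 2 * eta1 + 4 * eta2) delta
          <= numMC S B (beta + 2 * eta1 + 4 * eta2) delta)%E /\
       (forall m : R, mdim S B eta1 eta2 = m%:E ->
          (numMC S B (beta + 2 * eta1 + 4 * eta2) delta
             <= (C * bound1 m beta eta1 eta2 delta)%:E)%E)) /\
    (forall eps delta : R, in_half eps -> in_half delta ->
       (mdim S B (eps / 7) (eps / 7) <= fat2 (eps / 7) S B)%E /\
       (numMA S B eps delta <= numMC S B eps delta)%E /\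
       (forall m : R, mdim S B (eps / 7) (eps / 7) = m%:E ->
          (numMC S B eps delta <= (C * bound2 m eps delta)%:E)%E)).
Proof.
have c0 := main_const_gt0 R; have s7 : (1 : R) <= 7 ^+ 6 by apply: exprn_ege1; lra.
(* The second factor comes from replacing [eps / 7] by [eps]; it exceeds the factor 2 required for
   the first bound. *)
pose C : R := main_const R * (2 * (16 * 7 ^+ 6)).
exists C; split; first by rewrite /C !mulr_gt0//; lra.
move=> X x0 S B hS hB.
have core m beta eta1 eta2 delta : in_half beta -> in_half eta1 -> in_half eta2 ->
    in_half delta -> mdim S B eta1 eta2 = m%:E ->
    (numMC S B (beta + 2 * eta1 + 4 * eta2) delta <=
       (main_const R * main_bound m beta delta)%:E)%E.
  move=> hb h1 h2 hd mE; have [d [dm dvc]] := mdim_dual_vc mE.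
  (* Classical choice equips the arbitrary type [X] with the equality test and choice structure used
     by the learner. *)
  exact: (@numMC_main R {classic X} S B m d beta eta1 eta2 delta).
split=> [beta eta1 eta2 delta hb h1 h2 hd|eps delta he hd].
  split=> [|m mE]; first exact: numMA_le_numMC.
  have m0 := mdim_ge0 mE.
  apply: le_trans (core _ _ _ _ _ hb h1 h2 hd mE) _; rewrite lee_fin /C -mulrA.
  rewrite ler_pM2l//; have h := main_bound_le_bound1 m0 hb h1 h2 hd.
  have := main_bound_ge0 m0 hb hd; nra.
split; first exact: mdim_le_fat2.
split=> [|m mE]; first exact: numMA_le_numMC.
have h7 := in_half_div7 he; have := core _ _ _ _ _ h7 h7 h7 hd mE.
(* The three error terms take 1, 2 and 4 shares of [eps], whence the division by 7. *)
have -> : eps / 7 + 2 * (eps / 7) + 4 * (eps / 7) = eps by field.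
move=> h; apply: le_trans h _; rewrite lee_fin /C -mulrA ler_pM2l//.
exact: main_bound_le_bound2 (mdim_ge0 mE) he hd.
Qed.
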